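(* Let $X=X_1\times X_2$ and $Y=Y_1\times Y_2$ be products of Polish spaces, let $\mu\in\mathcal{P}(X)$ and $\nu\in\mathcal{P}(Y)$, and let $c=c_1+c_2:X\times Y\to[0,\infty)$ be a lower semicontinuous separable cost function. Then for every pivot measure $\zeta\in\mathcal{P}(Y_1\times X_2)$ between $\mu$ and $\nu$, $$W_c(\mu,\nu)=\int_{X_2}W_{c_1}(\mu_{|x_2},\zeta_{|x_2})\,d\mu_2(x_2)+\int_{Y_1}W_{c_2}(\zeta_{|y_1},\nu_{|y_1})\,d\nu_1(y_1).$$
   Context: $\mathcal{P}(Z)$ denotes the Borel probability measures on a Polish space $Z$; $T_\#$ denotes push-forward; $\mathfrak{p}_A$ denotes the projection onto the factor(s) $A$. Points are written $\mathbf{x}=(x_1,x_2)\in X_1\times X_2$, $\mathbf{y}=(y_1,y_2)\in Y_1\times Y_2$. Separable cost: $c(\mathbf{x},\mathbf{y})=c_1(x_1,y_1)+c_2(x_2,y_2)$ with $c_1:X_1\times Y_1\to\mathbb{R}$, $c_2:X_2\times Y_2\to\mathbb{R}$ (when $c\ge 0$ is lower semicontinuous, $c_1,c_2$ are lower semicontinuous and bounded below, so integrals against probability measures are defined in $(-\infty,+\infty]$). Wasserstein cost: $W_c(\mu,\nu)=\inf_{\pi}\int c\,d\pi$ over the set $\Pi(\mu,\nu)$ of probability measures on the product with marginals $\mu$ and $\nu$; $W_{c_1},W_{c_2}$ are defined in the same way on $\mathcal{P}(X_1)\times\mathcal{P}(Y_1)$ and $\mathcal{P}(X_2)\times\mathcal{P}(Y_2)$.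 Cardinal flows: $\mathcal{F}(\mu,\nu)$ is the set of pairs $(f^{(1)},f^{(2)})\in\mathcal{P}(X\times Y_1)\times\mathcal{P}(X_2\times Y)$ such that $(\mathfrak{p}_X)_\#f^{(1)}=\mu$, $(\mathfrak{p}_Y)_\#f^{(2)}=\nu$ and $(\mathfrak{p}_{Y_1\times X_2})_\#f^{(1)}=(\mathfrak{p}_{Y_1\times X_2})_\#f^{(2)}$. The cardinal flow functional is $\mathbb{CT}_c(f^{(1)},f^{(2)})=\int_{X\times Y_1}c_1(x_1,y_1)\,df^{(1)}+\int_{X_2\times Y}c_2(x_2,y_2)\,df^{(2)}$. A cardinal flow is optimal if it minimizes $\mathbb{CT}_c$ over $\mathcal{F}(\mu,\nu)$. Pivot measure: $\zeta\in\mathcal{P}(Y_1\times X_2)$ is a pivot measure between $\mu$ and $\nu$ if there is an optimal cardinal flow $(f^{(1)},f^{(2)})\in\mathcal{F}(\mu,\nu)$ with $(\mathfrak{p}_{Y_1\times X_2})_\#f^{(1)}=(\mathfrak{p}_{Y_1\times X_2})_\#f^{(2)}=\zeta$. (Then the $X_2$-marginal of $\zeta$ is $\mu_2$ and its $Y_1$-marginal is $\nu_1$.) Marginals and conditional laws: $\mu_2=(\mathfrak{p}_{X_2})_\#\mu$, $\nu_1=(\mathfrak{p}_{Y_1})_\#\nu$. The conditional laws $\mu_{|x_2}\in\mathcal{P}(X_1)$ and $\zeta_{|x_2}\in\mathcal{P}(Y_1)$ come from disintegrating $\mu$ and $\zeta$ with respect to $x_2$ (over $\mu_2$); $\zeta_{|y_1}\in\mathcal{P}(X_2)$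 and $\nu_{|y_1}\in\mathcal{P}(Y_2)$ come from disintegrating $\zeta$ and $\nu$ with respect to $y_1$ (over $\nu_1$). *)

(* Defs.v *)
From HB Require Import structures.
From mathcomp Require Import all_boot all_order all_algebra.
From mathcomp Require Import all_classical all_reals all_analysis.

Set Implicit Arguments.
Unset Strict Implicit.
Unset Printing Implicit Defensive.

Import Order.TTheory GRing.Theory Num.Theory.
Import numFieldNormedType.Exports.

Local Open Scope classical_set_scope.
Local Open Scope ring_scope.

(* The library has no join of the pointed and topological structures of a
   product. *)
HB.instance Definition _ (X Y : ptopologicalType) := Pointed.on (X * Y)%type.

Definition separable_space (T : topologicalType) : Prop :=
  exists2 S : set T, countable S & dense S.

Definition is_metric (R : realType) (T : Type) (dist : T -> T -> R) : Prop :=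
  [/\ forall x y, dist x y = 0 <-> x = y,
      forall x y, dist x y = dist y x
    & forall x y z, dist x z <= dist x y + dist y z].

Definition metrizes (R : realType) (T : topologicalType)
    (dist : T -> T -> R) : Prop :=
  forall (x : T) (A : set T),
    nbhs x A <-> exists2 e : R, 0 < e & [set y | dist x y < e] `<=` A.

Definition cauchy_seq (R : realType) (T : Type) (dist : T -> T -> R)
    (u : nat -> T) : Prop :=
  forall e : R, 0 < e -> exists N : nat,
    forall m n : nat, (N <= m)%N -> (N <= n)%N -> dist (u m) (u n) < e.

Definition completely_metrizable (R : realType) (T : topologicalType) : Prop :=
  exists dist : T -> T -> R,
    [/\ is_metric dist, metrizes dist
      & forall u : nat -> T, cauchy_seq dist u -> exists l : T, u @ \oo --> l].

Definition polish_space (R : realType) (T : topologicalType) : Prop :=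
  separable_space T /\ completely_metrizable R T.

(* On a product, [borel (X * Y)] is the Borel sigma-algebra of the product
   topology.  Measurable types are pointed, hence the pointed topological
   spaces; a space that carries a probability measure is nonempty anyway. *)
Definition borel (T : ptopologicalType) : measurableType _ :=
  g_sigma_algebraType (@open T).
Arguments borel T%_type_scope.

(* A measure is a function on all subsets of its space, whose values outside
   the sigma-algebra are irrelevant. *)
Definition same_measure (d : measure_display) (T : measurableType d)
    (R : realType) (m1 m2 : set T -> \bar R) : Prop :=
  forall A, measurable A -> m1 A = m2 A.

Section transport.
Context {R : realType} {X Y : ptopologicalType}.
Implicit Types (mu : {measure set (borel X) -> \bar R})
  (nu : {measure set (borel Y) -> \bar R}).

Definition couplings mu nu : set (probability (borel (X * Y)) R) :=
  [set pi | same_measure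
              (pushforward pi (fst : borel (X * Y) -> borel X)) mu /\
            same_measure
              (pushforward pi (snd : borel (X * Y) -> borel Y)) nu].

Definition wasserstein (c : X -> Y -> R) mu nu : \bar R :=
  ereal_inf [set (\int[pi]_z (c z.1 z.2)%:E)%E | pi in couplings mu nu].

End transport.

(* [k] is a version of the conditional law of [q] given [p] under [gamma]:
   gamma (p \in A, q \in B) is the integral of k(s, B) over s \in A against the
   law of p.  Such a version is unique up to a null set of the law of p. *)
Definition conditional_law {R : realType} {Z S T : ptopologicalType}
    (gamma : probability (borel Z) R) (p : Z -> S) (q : Z -> T)
    (k : R.-pker borel S ~> borel T) : Prop :=
  forall (A : set (borel S)) (B : set (borel T)),
    measurable A -> measurable B ->
    gamma (p @^-1` A `&` q @^-1` B) =
    (\int[pushforward gamma (p : borel Z -> borel S)]_(s in A) k s B)%E.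

Section cardinal_flows.
Context {R : realType} {X1 X2 Y1 Y2 : ptopologicalType}.

Definition separable_cost (c1 : X1 -> Y1 -> R) (c2 : X2 -> Y2 -> R)
    (x : X1 * X2) (y : Y1 * Y2) : R :=
  c1 x.1 y.1 + c2 x.2 y.2.

Definition flow1_src (z : borel (X1 * X2 * Y1)) : borel (X1 * X2) := z.1.
Definition flow1_mid (z : borel (X1 * X2 * Y1)) : borel (Y1 * X2) :=
  (z.2, z.1.2).
Definition flow2_tgt (z : borel (X2 * (Y1 * Y2))) : borel (Y1 * Y2) := z.2.
Definition flow2_mid (z : borel (X2 * (Y1 * Y2))) : borel (Y1 * X2) :=
  (z.2.1, z.1).

Definition flow : Type := probability (borel (X1 * X2 * Y1)) R *
                          probability (borel (X2 * (Y1 * Y2))) R.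

Implicit Types (mu : probability (borel (X1 * X2)) R)
  (nu : probability (borel (Y1 * Y2)) R) (f g : flow)
  (zeta : probability (borel (Y1 * X2)) R).

Definition cardinal_flows mu nu : set flow :=
  [set f : flow | [/\ same_measure (pushforward f.1 flow1_src) mu,
                      same_measure (pushforward f.2 flow2_tgt) nu
                    & same_measure (pushforward f.1 flow1_mid)
                                   (pushforward f.2 flow2_mid)]].

Definition flow_cost (c1 : X1 -> Y1 -> R) (c2 : X2 -> Y2 -> R) f : \bar R :=
  (\int[f.1]_z (c1 z.1.1 z.2)%:E + \int[f.2]_z (c2 z.1 z.2.2)%:E)%E.

Definition optimal_flow (c1 : X1 -> Y1 -> R) (c2 : X2 -> Y2 -> R) mu nu f :
    Prop :=
  cardinal_flows mu nu f /\
  forall g, cardinal_flows mu nu g ->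
    (flow_cost c1 c2 f <= flow_cost c1 c2 g)%E.

Definition pivot (c1 : X1 -> Y1 -> R) (c2 : X2 -> Y2 -> R) mu nu zeta : Prop :=
  exists f, [/\ optimal_flow c1 c2 mu nu f,
                same_measure (pushforward f.1 flow1_mid) zeta
              & same_measure (pushforward f.2 flow2_mid) zeta].

End cardinal_flows.

(* Main.v *)
Require Import Defs.
From HB Require Import structures.
From mathcomp Require Import all_boot all_order all_algebra.
From mathcomp Require Import all_classical all_reals all_analysis.
From mathcomp Require Import measurable_realfun.
From mathcomp Require Import ring lra.

Set Implicit Arguments.
Unset Strict Implicit.
Unset Printing Implicit Defensive.

Import Order.TTheory GRing.Theory Num.Theory.
Import numFieldNormedType.Exports.

Local Open Scope classical_set_scope.
Local Open Scope ring_scope.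

(* Projecting a coupling of [mu] and [nu] gives a flow of the same cost, and two
   flow components can be glued along their common projection; so it suffices
   to compute the least cost of a flow component with prescribed marginals,
   e.g. of [f1] with [(x1, x2)]-law [mu] and [(y1, x2)]-law [zeta], and to show
   that it is the integral of the fiberwise Wasserstein costs.  After shifting
   constants, [c1, c2 >= 0].

   Neither regular conditional laws nor measurable selections are used.  A
   nonnegative lsc cost is the increasing limit of costs taking finitely many
   values on rectangles; for these, the fiber over [q] is a finite transport
   problem whose data are measurable in [q].  The optimum of a finite transport
   problem is Lipschitz in its marginals, so one may cut the base into finitely
   many cells on which the data are almost constant and solve one problem per
   cell.  The limit is taken along an ultrafilter: a limit of couplings is
   finitely additive with countably additive marginals, and tightness of one
   marginal (Ulam) makes it countably additive on rectangles.  That two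
   [q]-coordinates agree almost surely, and hence gluing, also passes to the
   limit. *)

(** * Polish spaces *)

(** The obstacle is the dependence on the base point [q]: fiberwise optimal costs must be measurable
    in [q], and fiberwise near-optimal couplings must be assembled into one measure. Everything is
    therefore phrased through rectangles with measurable sides. A truncated cost sees a coupling
    only through the masses of finitely many rectangles, and the event that two [q]-coordinates
    differ is a countable union of rectangles, [W i] times its complement, for a countable base [W].
    So it is enough that a limit of couplings controls the masses of rectangles; lower
    semicontinuity enters only where the cost is written as a countable supremum over base
    rectangles.

    The optimality in the notion of pivot serves one inequality. Gluing along any [zeta] with the
    right marginals bounds the Wasserstein cost from above by the sum of the two integrals.
    Conversely, a coupling projects to a flow, which costs at least as much as the flow behind the
    pivot, and the latter costs at least that sum. *)

Section metric.
Context {R : realType} {T : topologicalType} (dist : T -> T -> R).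
Hypothesis dist_metric : is_metric dist.
Hypothesis dist_top : metrizes dist.

Let distxx x : dist x x = 0.
Proof. by case: dist_metric => h _ _; apply/h. Qed.

Let distC x y : dist x y = dist y x.
Proof. by case: dist_metric. Qed.

Let dist_triangle y x z : dist x z <= dist x y + dist y z.
Proof. by case: dist_metric. Qed.

Lemma metric_ge0 x y : 0 <= dist x y.
Proof. by have := dist_triangle y x x; rewrite distxx (distC y x); lra. Qed.

Lemma metric_ball_open x e : open [set y | dist x y < e].
Proof.
rewrite openE => y /= xy; apply/dist_top.
exists (e - dist x y); first by rewrite subr_gt0.
by move=> z /=; have := dist_triangle y x z; lra.
Qed.

Lemma metric_cball_closed x e : closed [set y | dist x y <= e].
Proof.
rewrite -openC openE => y /= /negP; rewrite -ltNge => xy; apply/dist_top.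
exists (dist x y - e); first by rewrite subr_gt0.
move=> z /= yz; apply/negP; rewrite -ltNge.
by have := dist_triangle z x y; rewrite (distC z y); lra.
Qed.

Lemma metric_dense_seq (S : set T) (e : R) x : dense S -> 0 < e ->
  exists2 y, S y & dist y x < e.
Proof.
move=> dS e0; have [|y [/= xy Sy]] := dS _ _ (metric_ball_open x e).
  by exists x; rewrite /= distxx.
by exists y => //; rewrite distC.
Qed.

(** The index decodes to a pair [(a, k)]. The union runs over the centres in [S] of code [a], at
    most one when [f] is injective on [S]; a code that is not attained gives the empty set. *)
Definition open_ratio_ball (S : set T) (f : T -> nat) (n : nat) : set T :=
  if unpickle n is Some (a, k) then
    \bigcup_(y in [set y | S y /\ f y = a]) [set z | dist y z < k.+1%:R^-1]
  else set0.

End metric.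

Lemma inv_succ_lt (R : realType) (e : R) : 0 < e -> exists k : nat, k.+1%:R^-1 < e.
Proof.
by move=> e0; have [k _ /(_ k (leqnn k))] := near_infty_natSinv_lt (PosNum e0); exists k.
Qed.

Definition base_seq (T : topologicalType) (U : nat -> set T) : Prop :=
  (forall i, open (U i)) /\
  (forall x A, nbhs x A -> exists2 i, U i x & U i `<=` A).

Lemma polish_base (R : realType) (T : topologicalType) : polish_space R T ->
  exists U : nat -> set T, base_seq U.
Proof.
move=> [[S /countable_injP[f finj] dS] [dist [dm dt _]]].
exists (open_ratio_ball dist S f); split=> [n|x A].
  rewrite /open_ratio_ball; case: unpickle => [[a k]|]; last exact: open0.
  by apply: bigcup_open => y _; exact: metric_ball_open.
move=> /dt[e e0 eA].
have [k ke] : exists k, k.+1%:R^-1 < e / 2 by apply: inv_succ_lt; rewrite divr_gt0.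
have [|y Sy yx] := metric_dense_seq dm dt (e := k.+1%:R^-1) x dS.
  by rewrite invr_gt0.
case: (dm) => _ distC dtri.
exists (pickle (f y, k)); rewrite /open_ratio_ball pickleK; first by exists y.
move=> z [y' [Sy' fy']]; have {y' fy' Sy'}-> : y' = y by apply: finj => //; rewrite inE.
move=> /= yz; apply: eA => /=; apply: (le_lt_trans (dtri x y z)).
by rewrite (splitr e) ltrD// ?(distC x y) ?(lt_trans _ ke).
Qed.

Lemma polish_separated (R : realType) (T : topologicalType) (x y : T) :
  polish_space R T -> x <> y -> exists2 A, nbhs x A & ~ A y.
Proof.
move=> [_ [dist [dm dt _]]] xy; exists [set z | dist x z < dist x y]; last first.
  by rewrite /= ltxx.
have [d0 _ _] := dm; apply/dt; exists (dist x y) => //.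
by rewrite lt_neqAle (metric_ge0 dm) andbT eq_sym; apply/eqP => /d0.
Qed.

(** * Probabilities as real numbers *)

Section prob.
Context {R : realType} d {T : measurableType d}.
Implicit Types (P : probability T R) (A B C : set T).

Definition prob P A : R := fine (P A).

Lemma probE P A : measurable A -> P A = (prob P A)%:E.
Proof. by move=> mA; rewrite /prob fineK// fin_num_measure. Qed.

Lemma prob_ge0 P A : 0 <= prob P A.
Proof. exact: fine_ge0. Qed.

Lemma prob_setT P : prob P setT = 1.
Proof. by rewrite /prob probability_setT. Qed.

Lemma prob_set0 P : prob P set0 = 0.
Proof. by rewrite /prob measure0. Qed.

Lemma le_prob P A B : measurable A -> measurable B -> A `<=` B ->
  prob P A <= prob P B.
Proof.
by move=> mA mB AB; rewrite -lee_fin -!probE// le_measure// inE.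
Qed.

Lemma prob_le1 P A : measurable A -> prob P A <= 1.
Proof. by move=> mA; rewrite -(prob_setT P) le_prob. Qed.

Lemma probU P A B : measurable A -> measurable B -> A `&` B = set0 ->
  prob P (A `|` B) = prob P A + prob P B.
Proof.
move=> mA mB AB; apply: EFin_inj; rewrite EFinD -!probE ?measureU//.
exact: measurableU.
Qed.

Lemma prob_leU P A B C : measurable A -> measurable B -> measurable C ->
  A `<=` B `|` C -> prob P A <= prob P B + prob P C.
Proof.
move=> mA mB mC ABC; rewrite -lee_fin EFinD -!probE//.
apply: le_trans (measureU2 _ mB mC); rewrite le_measure ?inE//.
exact: measurableU.
Qed.

Lemma prob_partition P (I : finType) (a : T -> I) A :
  (forall i, measurable (a @^-1` [set i])) -> measurable A ->
  prob P A = \sum_i prob P (A `&` a @^-1` [set i]).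
Proof.
move=> ma mA.
have mi i : measurable (A `&` a @^-1` [set i]) by exact: measurableI.
have H s : uniq s -> measurable (A `&` [set x | a x \in s]) /\
    prob P (A `&` [set x | a x \in s]) = \sum_(i <- s) prob P (A `&` a @^-1` [set i]).
  elim: s => [_|j s ih /= /andP[js /ih[ms sE]]].
    have -> : [set x | a x \in [::]] = set0 by apply/seteqP; split => x.
    by rewrite big_nil setI0 prob_set0.
  have -> : A `&` [set x | a x \in j :: s] =
      (A `&` a @^-1` [set j]) `|` (A `&` [set x | a x \in s]).
    apply/seteqP; split => x /=; rewrite inE.
      by move=> [Ax /orP[/eqP|]]; [left|right].
    by move=> [[Ax ->]|[Ax ->]]; rewrite ?eqxx ?orbT.
  split; first exact: measurableU.
  rewrite probU// ?big_cons ?sE//; apply/seteqP; split => // x /= [[_ ->] [_]].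
  by move=> js'; rewrite js' in js.
have [_ <-] := H _ (index_enum_uniq I).
by congr (prob P _); apply/seteqP; split => [x Ax|x []//]; split => //=; rewrite mem_index_enum.
Qed.

Lemma measurable_label (I : finType) (a : T -> I) (Q : set I) :
  (forall i, measurable (a @^-1` [set i])) -> measurable (a @^-1` Q).
Proof.
move=> ma; rewrite (_ : _ @^-1` _ = \bigcup_(i in Q) a @^-1` [set i]); last first.
  by apply/seteqP; split => [x Qx|x [i /[swap] /= <-]//]; exists (a x).
by apply: fin_bigcup_measurable => [|i _]; [exact: finite_finset|exact: ma].
Qed.

(** Continuity from above along the remainders, whose intersection is empty. This is how countable
    covers are cut down to finite ones in the sequel. *)
Lemma prob_cover_small P A (B : nat -> set T) (e : R) : measurable A ->
  (forall i, measurable (B i)) -> A `<=` \bigcup_i B i -> 0 < e ->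
  exists n, prob P (A `\` \bigcup_(i in `I_n) B i) < e.
Proof.
move=> mA mB AB e0; pose F n := A `\` \bigcup_(i in `I_n) B i.
have mF n : measurable (F n).
  by apply: measurableD => //; exact: bigcup_measurable.
have F0 : \bigcap_n F n = set0.
  apply/seteqP; split => // x Fx.
  have [i _ Bix] := AB _ (Fx 0%N I).1.
  by have [_] := Fx i.+1 I; apply; exists i => /=.
have /= := @nonincreasing_cvg_mu _ _ _ P F.
rewrite F0 measure0 => /(_ _ mF measurable0).
have F0oo : (P (F 0%N) < +oo)%E by rewrite -ge0_fin_numE// fin_num_measure.
have Fdec : {homo F : n m / (n <= m)%N >-> (m <= n)%O}.
  move=> n m nm; apply/subsetPset => x [Ax h]; split => // -[i /= in_ Bi].
  by apply: h; exists i => //=; exact: leq_trans nm.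
move=> /(_ F0oo Fdec) /fine_cvgP[_] /cvgrPdist_lt/(_ _ e0)[n _ /(_ n (leqnn _))] /=.
rewrite sub0r normrN ger0_norm; last exact: fine_ge0.
by exists n.
Qed.

Lemma prob_bigcup_le_geometric P (A : nat -> set T) (e : R) :
  (forall i, measurable (A i)) ->
  (forall i, prob P (A i) < e / (2 ^ i.+1)%:R) -> 0 <= e ->
  prob P (\bigcup_i A i) <= e.
Proof.
move=> mA Ae e0; have mU : measurable (\bigcup_i A i) by exact: bigcup_measurable.
rewrite -lee_fin -probE//.
apply: (le_trans (generalized_Boole_inequality P mA mU)).
apply: le_trans (epsilon_trick0 xpredT e0).
by apply: lee_nneseries => [//|i _] /=; rewrite [leLHS](probE P)// lee_fin ltW.
Qed.

End prob.

Section push.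
Context {R : realType} d d' {T : measurableType d} {T' : measurableType d'}.

Lemma pushforward_probability (P : probability T R) (f : T -> T') :
  measurable_fun setT f ->
  exists Q : probability T' R, (Q : set T' -> \bar R) = pushforward P f.
Proof.
move=> mf; pose F : {mfun T >-> T'} := HB.pack f (isMeasurableFun.Build _ _ _ _ _ mf).
by exists (distribution P F).
Qed.

End push.

Section mass_one.
Context {R : realType} d {T : measurableType d}.
Variable m : {measure set T -> \bar R}.
Hypothesis m1 : m setT = 1%E.

(** The proof of [m setT = 1] is an argument so that the probability structure, which depends on it,
    can be attached to this constant. *)
Definition mass_one of m setT = 1%E := fun A : set T => m A.

Let mass_one0 : mass_one m1 set0 = 0%E. Proof. exact: measure0. Qed.

Let mass_one_ge0 A : (0 <= mass_one m1 A)%E. Proof. exact: measure_ge0. Qed.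

Let mass_one_semi_sigma_additive : semi_sigma_additive (mass_one m1).
Proof. exact: measure_semi_sigma_additive. Qed.

HB.instance Definition _ := isMeasure.Build _ _ _ (mass_one m1)
  mass_one0 mass_one_ge0 mass_one_semi_sigma_additive.

HB.instance Definition _ := Measure_isProbability.Build _ _ _ (mass_one m1) m1.

Lemma measure_probability :
  exists P : probability T R, (P : set T -> \bar R) = m.
Proof. by exists (mass_one m1). Qed.

End mass_one.

Section borel.
Context {T T' : ptopologicalType}.

Lemma borel_open (A : set T) : open A -> measurable (A : set (borel T)).
Proof. by move=> oA; exact: sub_sigma_algebra. Qed.

Lemma borel_closed (A : set T) : closed A -> measurable (A : set (borel T)).
Proof.
by move=> cA; rewrite -(setCK A); apply: measurableC; apply: borel_open; rewrite openC.
Qed.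

Lemma continuous_borel (f : T -> T') : continuous f ->
  measurable_fun setT (f : borel T -> borel T').
Proof.
move=> cf; apply: (@measurability _ _ (borel T) (borel T') setT f (@open T') erefl).
move=> _ [B oB <-]; rewrite setTI; apply: borel_open.
by apply: open_comp => // x _; exact: cf.
Qed.

End borel.

(** * Regularity and tightness *)

Section regularity.
Context {R : realType} {T : ptopologicalType} (N : probability (borel T) R).

Definition sandwiched (B : set T) : Prop := forall e : R, 0 < e ->
  exists F V : set T, [/\ closed F, open V, F `<=` B, B `<=` V
                        & prob N (V `\` F : set (borel T)) < e].

Let mOF (V F : set T) : open V -> closed F -> measurable (V `\` F : set (borel T)).
Proof.
by move=> oO cF; apply: measurableD; [exact: borel_open|exact: borel_closed].
Qed.

Lemma sandwichedC B : sandwiched B -> sandwiched (~` B).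
Proof.
move=> rB e /rB[F [V [cF oO FB BO OF]]]; exists (~` V), (~` F).
rewrite closedC openC; split => //; [exact: subsetC|exact: subsetC|].
by rewrite setDE setCK setIC -setDE.
Qed.

(** A countable union of closed sets need not be closed. Half of [e] pays for the geometric sum of
    the gaps, the other half for keeping only finitely many of the inner sets. *)
Lemma sandwiched_bigcup (B : nat -> set T) : (forall i, sandwiched (B i)) ->
  sandwiched (\bigcup_i B i).
Proof.
move=> rB e e0.
have e2 : 0 < e / 2 by rewrite divr_gt0.
have en i : 0 < (e / 2) / (2 ^ i.+1)%:R :> R by rewrite divr_gt0// ltr0n expn_gt0.
have /choice[F /choice[V h] ] := fun i => rB i _ (en i).
pose OO := \bigcup_i V i; pose FF := \bigcup_i F i.
have mF i : measurable (F i : set (borel T)) by apply: borel_closed; case: (h i).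
have mO : measurable (OO : set (borel T)).
  by apply: borel_open; apply: bigcup_open => i _; case: (h i).
have mFF : measurable (FF : set (borel T)) by apply: bigcup_measurable.
have [n hn] := prob_cover_small N mFF mF (@subset_refl _ _) e2.
exists (\bigcup_(i in `I_n) F i), OO; split => //.
- by apply: closed_bigcup => // i _; case: (h i).
- by apply: bigcup_open => i _; case: (h i).
- by move=> x [i _ Fx]; exists i => //; case: (h i) => _ _ + _ _; apply.
- by move=> x [i _ Fx]; exists i => //; case: (h i) => _ _ _ + _; apply.
have mDi i : measurable (V i `\` F i : set (borel T)).
  by case: (h i) => ? ? _ _ _; exact: mOF.
have mD : measurable (\bigcup_i (V i `\` F i) : set (borel T)) by exact: bigcup_measurable.
have mFn : measurable (FF `\` \bigcup_(i in `I_n) F i : set (borel T)).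
  by apply: measurableD => //; exact: bigcup_measurable.
have D2 : prob N (\bigcup_i (V i `\` F i) : set (borel T)) <= e / 2.
  by apply: prob_bigcup_le_geometric => // [i|]; [case: (h i)|exact: ltW].
rewrite (splitr e); apply: le_lt_trans (ler_ltD D2 hn).
apply: prob_leU => //.
  by apply: measurableD => //; exact: bigcup_measurable.
move=> x [[i _ Ox] nF]; have [Fx|Fx] := pselect (FF x); [by right|left].
by exists i => //; split => // Fi; apply: Fx; exists i.
Qed.

(** The sandwiched sets form a sigma-algebra. It contains the open sets, since an open [V] is the
    union of the closed sets of points at distance at least [1/(n+1)] from its complement. *)
Lemma borel_sandwiched (dist : T -> T -> R) (B : set (borel T)) :
  is_metric dist -> metrizes dist -> measurable B -> sandwiched B.
Proof.
move=> dm dt; suff : measurable `<=` [set A : set (borel T) | sandwiched A] by apply.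
apply: smallest_sub.
  split => /=.
  - move=> e e0; exists set0, set0; split => //; [exact: closed0|exact: open0|].
    by rewrite setD0 prob_set0.
  - by move=> A; rewrite setTD; exact: sandwichedC.
  - by move=> A; exact: sandwiched_bigcup.
move=> V oO /= e e0.
pose F n := \bigcap_(y in ~` V) ~` [set x | dist y x < n.+1%:R^-1].
have cF n : closed (F n).
  by apply: closed_bigI => y _; rewrite closedC; exact: metric_ball_open.
have mF n : measurable (F n : set (borel T)) by exact: borel_closed.
have FO n : F n `<=` V.
  move=> x Fx; apply: contrapT => Ox; apply: (Fx x Ox).
  by case: dm => d0 _ _ /=; rewrite (proj2 (d0 x x) erefl) invr_gt0.
have OF : V `<=` \bigcup_n F n.
  move=> x Ox; have /dt[r r0 rO] : nbhs x V by apply: open_nbhs_nbhs.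
  have [n nr] := inv_succ_lt r0; exists n => // y Oy /= yx; apply: Oy; apply: rO => /=.
  by case: dm => _ -> _; exact: lt_trans nr.
have mO : measurable (V : set (borel T)) by exact: borel_open.
have [n hn] := prob_cover_small N mO mF OF e0.
exists (\bigcup_(i in `I_n) F i), V; split => //.
  by apply: closed_bigcup => // i _; exact: cF.
by move=> x [i _]; exact: FO.
Qed.

Lemma ultra_bigcup (X : Type) (G : set_system X) (n : nat) (A : nat -> set X) :
  UltraFilter G -> G (\bigcup_(i in `I_n) A i) -> exists i, G (A i).
Proof.
move=> UG; elim: n => [|n ih].
  by rewrite II0 bigcup_set0 => /filter_not_empty.
move=> GA; have [?|GC] := in_ultra_setVsetC (A n) UG; first by exists n.
apply: ih; apply: filterS2 GA GC => x [i /= + Ai] nA.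
by rewrite ltnS leq_eqVlt => /predU1P[iE|ilt]; [rewrite iE in Ai|exists i].
Qed.

(** An ultrafilter containing [K] selects one ball at every scale. Points chosen in the
    intersections of the first [n] selected balls form a Cauchy sequence, and its limit is a limit
    of the ultrafilter. *)
Lemma totally_bounded_compact (dist : T -> T -> R) (K : set T) :
  is_metric dist -> metrizes dist ->
  (forall u : nat -> T, cauchy_seq dist u -> exists l : T, u @ \oo --> l) ->
  closed K ->
  (forall k : nat, exists (n : nat) (s : nat -> T),
    K `<=` \bigcup_(i in `I_n) [set x | dist (s i) x <= k.+1%:R^-1]) ->
  compact K.
Proof.
move=> dm dt dc cK tb; rewrite compact_ultra => G UG GK.
have [_ dC dtri] := dm.
have /choice[s hs] : forall k, exists y, G [set x | dist y x <= k.+1%:R^-1].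
  move=> k; have [n [s sK]] := tb k; have [|i Gi] := @ultra_bigcup _ G n
    (fun i => [set x | dist (s i) x <= k.+1%:R^-1]) UG.
    exact: filterS sK GK.
  by exists (s i).
have GF n : G [set x | forall k, (k < n)%N -> dist (s k) x <= k.+1%:R^-1].
  elim: n => [|n ih]; first exact: filterS filterT.
  apply: filterS2 ih (hs n) => x /= hx xn k.
  by rewrite ltnS leq_eqVlt => /predU1P[->//|]; exact: hx.
have /choice[y hy] : forall n, exists y, forall k, (k <= n)%N -> dist (s k) y <= k.+1%:R^-1.
  by move=> n; have [y hy] := filter_ex (GF n.+1); exists y => k kn; apply: hy.
have hyy k m n : (k <= m)%N -> (k <= n)%N -> dist (y m) (y n) <= 2 * k.+1%:R^-1.
  move=> km kn; apply: (le_trans (dtri _ (s k) _)).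
  by rewrite mulr_natl mulr2n lerD// ?hy// dC hy.
have [|l yl] := dc y.
  move=> e e0; have [|k ke] := @inv_succ_lt _ (e / 2); first by rewrite divr_gt0.
  exists k => m n km kn; apply: (le_lt_trans (hyy k m n km kn)).
  by rewrite -ltr_pdivlMl// mulrC.
have sl e : 0 < e -> exists2 k, k.+1%:R^-1 < e & dist (s k) l < e.
  move=> e0; have [|k ke] := @inv_succ_lt _ (e / 2); first by rewrite divr_gt0.
  have [N0 _ hN] : \forall n \near \oo, dist l (y n) < e / 2.
    by apply: (yl [set z | dist l z < e / 2]); apply/dt; exists (e / 2) => //; rewrite divr_gt0.
  exists k; first by rewrite (lt_trans ke)// ltr_pdivrMr// ltr_pMr// ltr1n.
  have := dtri (s k) (y (maxn k N0)) l.
  have := hN (maxn k N0) (leq_maxr _ _); rewrite /= (dC l).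
  have := hy (maxn k N0) k (leq_maxl _ _).
  move=> h1 h2 h3; apply: (le_lt_trans h3).
  by rewrite (splitr e) ler_ltD// (le_trans h1)// ltW.
have Gl : G --> l.
  move=> A /dt[e e0 eA]; have [|k k1 k2] := sl (e / 2); first by rewrite divr_gt0.
  apply: filterS (hs k) => z /= skz; apply: eA => /=.
  apply: (le_lt_trans (dtri l (s k) z)); rewrite (splitr e) ltrD//.
    by rewrite dC.
  exact: le_lt_trans k1.
exists l; split => //; apply: cK => A lA.
by apply: (@filter_ex _ G); apply: filterI => //; exact: (Gl A lA).
Qed.

(** At scale [k], finitely many closed balls about a dense sequence cover all but a mass
    [e / 2^(k+1)]. The intersection over [k] of these finite unions is closed and totally
    bounded. *)
Lemma polish_tight (e : R) : polish_space R T -> 0 < e ->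
  exists2 K : set T, compact K /\ closed K & prob N (~` K : set (borel T)) <= e.
Proof.
move=> [[S /countable_injP[f finj] dS] [dist [dm dt dc]]] e0.
have en i : 0 < e / (2 ^ i.+1)%:R :> R by rewrite divr_gt0// ltr0n expn_gt0.
(* [s] inverts the coding [f] on [S]. The default [point] at other codes only adds balls, which does
   not spoil the covers. *)
pose s i := if pselect (exists2 y, S y & f y = i) is left h then projT1 (cid2 h) else point.
have sf y : S y -> s (f y) = y.
  move=> Sy; rewrite /s; case: pselect => [h|]; last by case; exists y.
  by case: cid2 => /= z Sz fz; apply: finj => //; rewrite inE.
pose B k i := [set x | dist (s i) x <= k.+1%:R^-1].
have cB k i : closed (B k i) by exact: metric_cball_closed.
have mB k i : measurable (B k i : set (borel T)) by exact: borel_closed.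
have BT k : setT `<=` \bigcup_i B k i.
  move=> x _; have [|y Sy yx] := metric_dense_seq dm dt (e := k.+1%:R^-1) x dS.
    by rewrite invr_gt0.
  by exists (f y) => //=; rewrite /B/= sf// ltW.
have /choice[n hn] := fun k => prob_cover_small N measurableT (mB k) (BT k) (en k).
pose K := \bigcap_k \bigcup_(i in `I_(n k)) B k i.
have cK : closed K.
  by apply: closed_bigI => k _; apply: closed_bigcup => // i _; exact: cB.
exists K.
  split=> //; apply: (totally_bounded_compact dm dt dc cK) => k.
  by exists (n k), s => x /(_ k I).
rewrite setC_bigcap; apply: prob_bigcup_le_geometric => [i||].
- by apply: measurableC; apply: bigcup_measurable.
- by move=> i; have := hn i; rewrite setTD.
- exact: ltW.
Qed.

Lemma polish_inner_compact (B : set (borel T)) (e : R) :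
  polish_space R T -> measurable B -> 0 < e ->
  exists K : set T, [/\ compact K, closed K, K `<=` B & prob N (B `\` K) < e].
Proof.
move=> pT mB e0; have [_ [dist [dm dt _]]] := pT.
have e2 : 0 < e / 2 by rewrite divr_gt0.
have [K [kK cK] hK] := polish_tight pT e2.
have [F [V [cF oO FB BO hF]]] := borel_sandwiched dm dt mB e2.
have mK : measurable (K : set (borel T)) by exact: borel_closed.
have mF : measurable (F : set (borel T)) by exact: borel_closed.
exists (K `&` F); split; first exact: compact_closedI.
- exact: closedI.
- by move=> x [_ /FB].
have mKF : measurable (K `&` F : set (borel T)) by exact: measurableI.
rewrite (splitr e); apply: le_lt_trans (ler_ltD hK hF); apply: prob_leU.
- exact: measurableD.
- exact: measurableC.
- exact: mOF.
move=> x [Bx nKF]; have [Kx|] := pselect (K x); last by left.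
by right; split; [exact: BO|move=> Fx; exact: nKF].
Qed.

Lemma polish_outer_open (B : set (borel T)) (e : R) :
  polish_space R T -> measurable B -> 0 < e ->
  exists V : set T, [/\ open V, B `<=` V & prob N (V `\` B) < e].
Proof.
move=> [_ [dist [dm dt _]]] mB e0.
have [F [V [cF oO FB BO hF]]] := borel_sandwiched dm dt mB e0.
exists V; split => //; apply: le_lt_trans hF; apply: le_prob.
- by apply: measurableD => //; exact: borel_open.
- exact: mOF.
- by move=> x [Ox nB]; split => // /FB.
Qed.

End regularity.

(** * Extension from rectangles *)

Lemma measurable_ffun_label d (T : measurableType d) (I : finType)
    (A : I -> set T) (i : {ffun I -> bool}) : (forall k, measurable (A k)) ->
  measurable ((fun s => [ffun k => `[< A k s >]]) @^-1` [set i]).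
Proof.
move=> mA; rewrite (_ : _ @^-1` _ = \bigcap_(k in [set: I]) if i k then A k else ~` A k).
  apply: fin_bigcap_measurable => [|k _]; first exact: finite_finset.
  by case: (i k) => //; exact: measurableC.
apply/seteqP; split => [s /= <- k _|s /= h].
  by rewrite ffunE; case: asboolP.
apply/ffunP => k; rewrite ffunE; have := h k Logic.I; case: (i k) => /= Aks.
  exact/asboolP.
exact/asboolP.
Qed.

Section rectangles.
Context d1 d2 (S : measurableType d1) (T : measurableType d2).

(** A copy of the product, to carry the semiring of rectangles beside the product sigma-algebra. *)
Definition rect_type : Type := (S * T)%type.

Definition rect : set (set rect_type) :=
  [set A `*` B | A in measurable & B in measurable].

Lemma rect0 : rect set0.
Proof. by exists set0 => //; exists set0 => //; rewrite set0X. Qed.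

Lemma rectI : setI_closed rect.
Proof.
move=> _ _ [A mA [B mB <-]] [A' mA' [B' mB' <-]].
by rewrite -setXI; exists (A `&` A'); [|exists (B `&` B')] => //; exact: measurableI.
Qed.

Lemma rectD : semi_setD_closed rect.
Proof.
move=> _ _ [A mA [B mB <-]] [A' mA' [B' mB' <-]].
exists [set (A `\` A') `*` B; (A `&` A') `*` (B `\` B')]; split.
- exact: finite_set2.
- move=> _ [] ->.
  + by exists (A `\` A'); [exact: measurableD|exists B].
  + by exists (A `&` A'); [exact: measurableI|exists (B `\` B') => //; exact: measurableD].
- rewrite bigcup_setU !bigcup_set1; apply/seteqP; split => -[s t] /=.
    move=> [[As Bt] nAB]; have [A's|A's] := pselect (A' s); last by left.
    by right; do 2 split => //; move=> B't; exact: nAB.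
  move=> [[[As nA's] Bt]|[[As A's] [Bt nB't]]]; do 2?split => //; by case.
- move=> _ _ [] -> [] -> // [[s t] /= []].
    by move=> [[_ A's] _] [[_ /A's]].
  by move=> [[_ A's] _] [[_ nA's]].
Qed.

Definition rect_display : Type -> measure_display. Proof. exact. Qed.

HB.instance Definition _ := Pointed.on rect_type.
HB.instance Definition _ := @isSemiRingOfSets.Build (rect_display rect_type)
  rect_type rect rect0 rectI rectD.

End rectangles.

Section rect_content.
Context {R : realType} d (S : measurableType d) (T : ptopologicalType).
Variables (M : probability S R) (N : probability (borel T) R).

(* A finitely additive mass on the product whose marginals are countably
   additive. *)
Definition additive_coupling (F : set (S * borel T) -> R) : Prop :=
  [/\ forall C, 0 <= F C,
      forall C D, measurable C -> measurable D -> C `&` D = set0 ->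
        F (C `|` D) = F C + F D,
      forall A, measurable A -> F (A `*` setT) = prob M A
    & forall B, measurable B -> F (setT `*` B) = prob N B].

Variable F : set (S * borel T) -> R.
Hypothesis FMN : additive_coupling F.

Let F_ge0 C : 0 <= F C. Proof. by case: FMN. Qed.

Let FU C D : measurable C -> measurable D -> C `&` D = set0 ->
  F (C `|` D) = F C + F D.
Proof. by case: FMN => _ + _ _; apply. Qed.

Let F0 : F set0 = 0.
Proof. by have := FU measurable0 measurable0 (setI0 _); rewrite setU0; lra. Qed.

Let leF C D : measurable C -> measurable D -> C `<=` D -> F C <= F D.
Proof.
move=> mC mD CD; rewrite -(setDUK CD) FU ?lerDl ?setDIK//.
exact: measurableD.
Qed.

Let leFU C D E : measurable C -> measurable D -> measurable E ->
  C `<=` D `|` E -> F C <= F D + F E.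
Proof.
move=> mC mD mE CDE; have mED : measurable (E `\` D) by exact: measurableD.
apply: (@le_trans _ _ (F D + F (E `\` D))).
  rewrite -FU ?setDIK//; apply: leF => //; first exact: measurableU.
  move=> x /CDE[Dx|Ex]; first by left.
  by have [Dx|Dx] := pselect (D x); [left|right].
by rewrite lerD2l leF//; exact: subDsetl.
Qed.

Let leFbig C n (D : nat -> set (S * borel T)) : measurable C ->
  (forall k, measurable (D k)) -> C `<=` \bigcup_(k in `I_n) D k ->
  F C <= \sum_(k < n) F (D k).
Proof.
move=> + mD; elim: n C => [|n ih] C mC.
  by rewrite II0 bigcup_set0 subset0 => ->; rewrite F0 big_ord0.
move=> CD; rewrite big_ord_recr/=.
apply: (le_trans (leFU mC (D := C `\` D n) (E := D n) _ (mD n) _)).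
- exact: measurableD.
- by move=> x Cx; have [Dx|Dx] := pselect (D n x); [right|left].
rewrite lerD2r; apply: ih; first exact: measurableD.
move=> x [/CD[k /=]]; rewrite ltnS leq_eqVlt => /predU1P[->//|kn Dk _].
by exists k.
Qed.

Let FM A B : measurable A -> measurable B -> F (A `*` B) <= prob M A.
Proof.
move=> mA mB; case: FMN => _ _ <-// _; apply: leF; try exact: measurableX.
by move=> [s t] [].
Qed.

Let FN A B : measurable A -> measurable B -> F (A `*` B) <= prob N B.
Proof.
move=> mA mB; case: FMN => _ _ _ <-//; apply: leF; try exact: measurableX.
by move=> [s t] [].
Qed.

(* Inner compact and outer open approximation in the second factor turn a
   countable cover of a rectangle into a cover that is finite above each [s];
   the number of rectangles needed is a measurable function of [s], hence
   bounded up to a set of small mass. *)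
Lemma rect_subadditive A B (Ak : nat -> set S) (Bk : nat -> set (borel T)) :
  polish_space R T -> measurable A -> measurable B ->
  (forall k, measurable (Ak k)) -> (forall k, measurable (Bk k)) ->
  A `*` B `<=` \bigcup_k (Ak k `*` Bk k) ->
  ((F (A `*` B))%:E <= \sum_(0 <= k <oo) (F (Ak k `*` Bk k))%:E)%E.
Proof.
move=> pT mA mB mAk mBk AB; apply/lee_addgt0Pr => e e0.
(* One third of [e] for replacing [B] by a compact [K], one for the points [s] that need more than
   [n] rectangles, one for enlarging each [Bk k] to an open [V k]. *)
have e3 : 0 < e / 3 by rewrite divr_gt0.
have en i : 0 < (e / 3) / (2 ^ i.+1)%:R :> R by rewrite divr_gt0// ltr0n expn_gt0.
have [K [kK cK KB hK]] := polish_inner_compact N pT mB e3.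
have mK : measurable (K : set (borel T)) by exact: borel_closed.
have /choice[V hV] := fun k => polish_outer_open N pT (mBk k) (en k).
have oV k : open (V k) by case: (hV k).
have mV k : measurable (V k : set (borel T)) by exact: borel_open.
(* Although it speaks of all points of [K], [G n] depends on [s] only through its membership in the
   first [n] sets [Ak k]; hence it is measurable. *)
pose G n := A `&` [set s | K `<=` \bigcup_(k in [set k | (k < n)%N /\ Ak k s]) V k].
have mG n : measurable (G n).
  pose a s := [ffun k : 'I_n => `[< Ak k s >]].
  have ma i : measurable (a @^-1` [set i]) by exact: measurable_ffun_label.
  apply: measurableI => //.
  rewrite (_ : [set s | _] =
      a @^-1` [set f : {ffun 'I_n -> bool} | K `<=` \bigcup_(k in [set k : 'I_n | f k]) V k]).
    exact: measurable_label.
  apply/seteqP; split => s /= Ks x /Ks [k /=].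
    by move=> [kn Ak_s] Vx; exists (Ordinal kn) => //=; rewrite ffunE; exact/asboolP.
  by rewrite ffunE => /asboolP Ak_s Vx; exists k.
have AG : A `<=` \bigcup_n G n.
  move=> s As; move: (kK); rewrite compact_cover.
  move=> /(_ nat [set k | Ak k s] V (fun k _ => oV k))[x Kx|D DA KD].
    have [k _ [/= Ak_s Bk_x]] := AB (s, x) (conj As (KB _ Kx)).
    by exists k => //; case: (hV k) => _ + _; apply.
  (* One more than the largest index of the finite subcover, because [G n] uses indices strictly
     below [n]. *)
  exists (\max_(k <- finmap.enum_fset D) k).+1 => //; split => // x /KD[k /= kD Vx].
  exists k => //; split; last by have := DA k kD; rewrite inE.
  by rewrite ltnS; apply: (@leq_bigmax_seq _ _ xpredT (fun k => k)).
have [n hn] := prob_cover_small M mA mG AG e3.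
set A' := A `\` _ in hn.
have mA' : measurable A' by apply: measurableD => //; exact: bigcup_measurable.
have mX C D : measurable C -> measurable D -> measurable (C `*` D : set (S * borel T)).
  by move=> *; exact: measurableX.
have mBK : measurable (B `\` K : set (borel T)) by exact: measurableD.
have h1 : F (A `*` B) <= F (A `*` (B `\` K)) + F (A `*` K).
  apply: leFU; try exact: mX.
  by move=> [s t] [/= As Bt]; have [Kt|Kt] := pselect (K t); [right|left].
have h2 : F (A `*` K) <= F (A' `*` K) + F (G n `*` K).
  apply: leFU; try exact: mX.
  move=> [s t] [/= As Kt]; have [A's|A's] := pselect (A' s); [by left|right].
  split => //=; have [i /= ltin [_ Gi]] : (\bigcup_(i in `I_n) G i) s.
    by apply: contrapT => nG; apply: A's.
  split => // x /Gi[k /= [ki Ak_s] Vx]; exists k => //; split => //.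
  exact: ltn_trans ltin.
have h3 : F (G n `*` K) <= \sum_(k < n) (F (Ak k `*` Bk k) + e / 3 / (2 ^ k.+1)%:R).
  have := @leFbig (G n `*` K) n (fun k => Ak k `*` V k) (mX _ _ (mG n) mK).
  move=> /(_ (fun k => mX _ _ (mAk k) (mV k))) h.
  apply: (le_trans (h _)).
    by move=> [s t] [/= [_ /[apply]]] [k /= [kn Ak_s] Vt]; exists k.
  apply: ler_sum => k _.
  have mVB : measurable (V k `\` Bk k : set (borel T)) by exact: measurableD.
  apply: (@le_trans _ _ (F (Ak k `*` Bk k) + F (Ak k `*` (V k `\` Bk k)))).
    apply: leFU; try exact: mX.
    by move=> [s t] [/= As Bt]; have [Kt|Kt] := pselect (Bk k t); [left|right].
  by rewrite lerD2l (le_trans (FN _ _))//; case: (hV k) => _ _ /ltW.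
have h4 : F (A `*` B) <= e / 3 + (e / 3 + \sum_(k < n) (F (Ak k `*` Bk k) + e / 3 / (2 ^ k.+1)%:R)).
  apply: (le_trans h1); apply: lerD; first by rewrite (le_trans (FN mA mBK))// ltW.
  apply: (le_trans h2); apply: lerD => //.
  by rewrite (le_trans (FM mA' mK))// ltW.
have h5 : ((\sum_(k < n) (F (Ak k `*` Bk k) + e / 3 / (2 ^ k.+1)%:R))%:E <=
    \sum_(0 <= k <oo) (F (Ak k `*` Bk k))%:E + (e / 3)%:E)%E.
  apply: le_trans (epsilon_trick xpredT _ (ltW e3)).
    rewrite -sumEFin -(big_mkord xpredT (fun k => (F (Ak k `*` Bk k) + e / 3 / (2 ^ k.+1)%:R)%:E)).
    under eq_bigr do rewrite EFinD.
    apply: nneseries_lim_ge => k *; apply: adde_ge0; rewrite lee_fin//.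
    exact: ltW.
  by move=> k; rewrite lee_fin.
have eE : e%:E = ((e / 3 + e / 3)%:E + (e / 3)%:E)%E :> \bar R.
  by rewrite -EFinD; congr (_%:E); lra.
set sn := \sum_(k < n) _ in h4 h5.
apply: (@le_trans _ _ ((e / 3 + e / 3)%:E + sn%:E)%E).
  by rewrite -EFinD lee_fin -addrA.
by rewrite eE addeCA leeD2l.
Qed.

End rect_content.

Section rect_extension.
Context {R : realType} d (S : measurableType d) (T : ptopologicalType).
Variables (M : probability S R) (N : probability (borel T) R).
Hypothesis pT : polish_space R T.
Variable F : set (S * borel T) -> R.
Hypothesis FMN : additive_coupling M N F.

(** As for [mass_one], the hypothesis is an argument because the content and measure structures
    attached to this function depend on it. *)
Definition rect_mass (_ : additive_coupling M N F) :
  set (rect_type S (borel T)) -> \bar R := fun C => (F C)%:E.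

Let rect_measurable (C : set (rect_type S (borel T))) :
  rect C -> measurable (C : set (S * borel T)).
Proof. by move=> [A mA [B mB <-]]; exact: measurableX. Qed.

Let rect_mass_ge0 C : (0 <= rect_mass FMN C)%E.
Proof. by rewrite lee_fin; case: FMN. Qed.

Let rect_mass_semi_additive : measure_function.semi_additive (rect_mass FMN).
Proof.
have [_ FU _ _] := FMN; move=> C n mC tC _.
have mC' k : measurable (C k : set (S * borel T)) by apply: rect_measurable; have := mC k.
rewrite /rect_mass; elim: n => [|n ih].
  rewrite !big_ord0; congr (_%:E).
  by have := FU _ _ measurable0 measurable0 (setI0 _); rewrite setU0; lra.
rewrite !big_ord_recr/= FU ?EFinD ?ih//; first exact: bigsetU_measurable.
rewrite -subset0 -bigcup_mkord => x [[k /= kn Ckx] Cnx].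
have /trivIsetP/(_ k n Logic.I Logic.I) := tC.
by rewrite (ltn_eqF kn) => /(_ isT); rewrite -subset0 => /(_ x); apply.
Qed.

HB.instance Definition _ := isContent.Build _ _ R (rect_mass FMN)
  rect_mass_ge0 rect_mass_semi_additive.

Let rect_mass_sigma_subadditive :
  measurable_subset_sigma_subadditive (rect_mass FMN).
Proof.
move=> C D mD [A mA [B mB <-]] CD.
have /choice[Ak hA] : forall k, exists A, measurable A /\
    exists2 B, measurable B & D k = A `*` B.
  by move=> k; have [A' mA' [B' mB' <-]] := mD k; exists A'; split => //; exists B'.
have /choice[Bk hB] : forall k, exists B, measurable B /\ D k = Ak k `*` B.
  by move=> k; have [_ [B' mB' ->]] := hA k; exists B'.
rewrite /rect_mass (eq_eseriesr (g := fun k => (F (Ak k `*` Bk k))%:E)).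
  apply: (rect_subadditive FMN) => //; [by move=> k; case: (hA k)|by move=> k; case: (hB k)|].
  by move=> x /CD[k _ Dx]; exists k => //; case: (hB k) => _ <-.
by move=> k _; case: (hB k) => _ <-.
Qed.

HB.instance Definition _ := Content_SigmaSubAdditive_isMeasure.Build _ _ _
  (rect_mass FMN) rect_mass_sigma_subadditive.

(** Caratheodory extension from the semiring of rectangles. Agreement with [F] is claimed on
    rectangles only, since elsewhere [F] need not be countably additive. *)
Lemma additive_coupling_extension : exists gam : probability (S * borel T)%type R,
  forall A B, measurable A -> measurable B -> prob gam (A `*` B) = F (A `*` B).
Proof.
pose m := measure_extension (rect_mass FMN : {measure set _ -> \bar R}).
have mE A B : measurable A -> measurable B -> m (A `*` B) = (F (A `*` B))%:E.
  move=> mA mB; rewrite /m /measure_extension measurable_mu_extE//=.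
  by exists A => //; exists B.
have mid : measurable_fun setT
    (id : g_sigma_algebraType (rect (S := S) (T := borel T)) -> S * borel T).
  move=> _ Y mY; rewrite setTI preimage_id.
  by move: mY; rewrite measurable_prod_measurableType.
have m1 : m setT = 1%E.
  rewrite -setXTT mE//; case: FMN => _ _ -> // _.
  by rewrite prob_setT.
have [P PE] := measure_probability m1.
have [Q QE] := pushforward_probability P mid.
exists Q => A B mA mB; apply: EFin_inj; rewrite -mE// -probE; last exact: measurableX.
by rewrite QE /pushforward preimage_id PE.
Qed.

End rect_extension.

(** * Limits of couplings and finite transport problems *)

(** Unlike [couplings], this lives on the product sigma-algebra, so that a factor may be any
    measurable space, for instance one that already carries a coupling. [coupled_couplings] passes
    to the Borel sets of the product. *)
Definition coupled (R : realType) d d' (S : measurableType d) (T : measurableType d')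
    (M : probability S R) (N : probability T R) (gam : probability (S * T)%type R) : Prop :=
  (forall A, measurable A -> prob gam (A `*` setT) = prob M A) /\
  (forall B, measurable B -> prob gam (setT `*` B) = prob N B).

Lemma ultra_cvg_segment (R : realType) (X : Type) (U : set_system X) (u : X -> R) :
  UltraFilter U -> (forall n, 0 <= u n <= 1) -> exists p : R, u @ U --> p.
Proof.
move=> UU u01; have uU : (u @ U) `[0, 1]%classic.
  by apply: (@filterE _ U) => n; rewrite /= in_itv; exact: u01.
have [p [_ pU]] := @segment_compact R 0 1 _ _ uU.
exists p => B pB; have [//|UB] := in_ultra_setVsetC (u @^-1` B) UU.
by have [x [] //] := pU (~` B) B UB pB.
Qed.

Section coupling_limit.
Context {R : realType} d (S : measurableType d) (T : ptopologicalType).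
Variables (M : probability S R) (N : probability (borel T) R).
Variable gam : nat -> probability (S * borel T)%type R.

(** Along an ultrafilter the masses of all measurable sets converge at once. The conclusion keeps
    the convergence on rectangles, where the extension agrees with the limiting set function. *)
Lemma coupling_limit : polish_space R T -> (forall n, coupled M N (gam n)) ->
  exists2 g : probability (S * borel T)%type R, coupled M N g &
  exists U : set_system nat, [/\ ProperFilter U, U --> \oo
    & forall A B, measurable A -> measurable B ->
      prob (gam n) (A `*` B) @[n --> U] --> prob g (A `*` B)].
Proof.
move=> pT gamMN.
have [U [UU ooU]] := @ultraFilterLemma nat \oo _.
have PU : ProperFilter U by exact: ultra_proper.
(* The value 0 off the sigma-algebra keeps [F] nonnegative on all sets, as [additive_coupling]
   demands. *)
have /choice[F hF] : forall C : set (S * borel T), exists p : R,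
    (measurable C -> prob (gam n) C @[n --> U] --> p) /\ (~ measurable C -> p = 0).
  move=> C; have [mC|mC] := pselect (measurable C); last by exists 0.
  have [|p] := @ultra_cvg_segment R _ U (fun n => prob (gam n) C) UU.
    by move=> n; rewrite prob_ge0 prob_le1.
  by exists p.
have Fcvg C : measurable C -> prob (gam n) C @[n --> U] --> F C by case: (hF C).
have FE C p : measurable C -> prob (gam n) C @[n --> U] --> p -> F C = p.
  by move=> /Fcvg h1 h2; apply: cvg_unique h1 h2; exact: norm_hausdorff.
have FMN : additive_coupling M N F.
  split.
  - move=> C; have [mC|mC] := pselect (measurable C); last by case: (hF C) => _ ->.
    apply: (cvgr_to_ge (Fcvg _ mC)); apply: (@filterE _ U) => n; exact: prob_ge0.
  - move=> C D mC mD CD; apply: FE; first exact: measurableU.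
    under eq_fun do rewrite probU//.
    by apply: cvgD; exact: Fcvg.
  - move=> A mA; apply: FE; first exact: measurableX.
    by under eq_fun do rewrite (proj1 (gamMN _))//; exact: cvg_cst.
  - move=> B mB; apply: FE; first exact: measurableX.
    by under eq_fun do rewrite (proj2 (gamMN _))//; exact: cvg_cst.
have [g gE] := additive_coupling_extension pT FMN.
exists g.
  by case: FMN => _ _ h1 h2; split => [A mA|B mB]; rewrite gE// ?h1 ?h2.
exists U; split => // A B mA mB; rewrite gE//; apply: Fcvg; exact: measurableX.
Qed.

End coupling_limit.

Section discrete_coupling.
Context {R : realType} {I J : finType}.

(** No normalization of the total mass: the problem attached to a cell of the base carries the mass
    of that cell. *)
Definition dcoupling (a : I -> R) (b : J -> R) (p : I -> J -> R) : Prop :=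
  [/\ forall i j, 0 <= p i j, forall i, \sum_j p i j = a i
    & forall j, \sum_i p i j = b j].

Definition dcost (C p : I -> J -> R) : R := \sum_i \sum_j C i j * p i j.

Lemma dcoupling_sum a b p : dcoupling a b p -> \sum_i a i = \sum_j b j.
Proof.
move=> [_ pa pb]; under eq_bigr do rewrite -pa; rewrite exchange_big/=.
by apply: eq_bigr.
Qed.

Lemma dcoupling_ge0 a b p : dcoupling a b p ->
  (forall i, 0 <= a i) /\ (forall j, 0 <= b j).
Proof. by move=> [p0 pa pb]; split => k; rewrite -?pa -?pb; exact: sumr_ge0. Qed.

Lemma dcouplingZ a b p (r : R) : 0 <= r -> dcoupling a b p ->
  dcoupling (fun i => r * a i) (fun j => r * b j) (fun i j => r * p i j).
Proof.
move=> r0 [p0 pa pb]; split => [i j|i|j]; first exact: mulr_ge0.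
  by rewrite -mulr_sumr pa.
by rewrite -mulr_sumr pb.
Qed.

Lemma dcostZ C p (r : R) : dcost C (fun i j => r * p i j) = r * dcost C p.
Proof.
rewrite /dcost mulr_sumr; apply: eq_bigr => i _; rewrite mulr_sumr.
by apply: eq_bigr => j _; rewrite mulrCA.
Qed.

(* With factors [r i], [s j] in [0, 1] such that [a i * r i = min (a i) (a' i)]
   and likewise for [s], the matrix [p i j * r i * s j] has marginals below
   [a'] and [b']; the missing mass is spread as a product. *)
Lemma dcoupling_perturb (C : I -> J -> R) (K : R) a b a' b' p :
  0 <= K -> (forall i j, 0 <= C i j <= K) -> dcoupling a b p ->
  (forall i, 0 <= a' i) -> (forall j, 0 <= b' j) ->
  \sum_i a' i = \sum_j b' j ->
  exists2 p', dcoupling a' b' p' &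
    dcost C p' <= dcost C p + K * (\sum_i `|a i - a' i| + \sum_j `|b j - b' j|).
Proof.
move=> K0 CK pab a'0 b'0 ab'.
have [a0 b0] := dcoupling_ge0 pab; have [p0 pa pb] := pab.
(* The factor is [min 1 (y / x)], read as 1 when [x = 0]. *)
have factor (x y : R) : 0 <= x -> 0 <= y ->
    exists r, [/\ 0 <= r <= 1, x * r <= y, x - `|x - y| <= x * r & y - `|x - y| <= x * r].
  move=> x0 y0; have [xy|yx] := leP x y.
    exists 1; rewrite mulr1 ler01 lexx; split => //; first by rewrite gerBl.
    by rewrite ler0_norm ?subr_le0// opprB subKr.
  have xn0 : 0 < x by exact: le_lt_trans yx.
  exists (y / x); rewrite divr_ge0// ler_pdivrMr// mul1r ltW//.
  rewrite mulrC divfK ?gt_eqF//; split => //.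
    by rewrite ger0_norm ?subr_ge0 ?(ltW yx)// subKr.
  by rewrite gerBl.
have /choice[r hr] := fun i => factor (a i) (a' i) (a0 i) (a'0 i).
have /choice[s hs] := fun j => factor (b j) (b' j) (b0 j) (b'0 j).
have r01 i : 0 <= r i <= 1 by case: (hr i).
have s01 j : 0 <= s j <= 1 by case: (hs j).
pose q i j := p i j * r i * s j.
have q0 i j : 0 <= q i j.
  by rewrite !mulr_ge0//; [case/andP: (r01 i)|case/andP: (s01 j)].
have qp i j : q i j <= p i j.
  have /andP[r0 r1] := r01 i; have /andP[s0 s1] := s01 j.
  by rewrite /q -mulrA ler_piMr// mulr_ile1.
have qa i : \sum_j q i j <= a' i.
  case: (hr i) => /andP[r0 _] + _ _; apply: le_trans; rewrite -pa mulr_suml.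
  apply: ler_sum => j _; have /andP[s0 s1] := s01 j.
  by rewrite ler_piMr// mulr_ge0.
have qb j : \sum_i q i j <= b' j.
  case: (hs j) => /andP[s0 _] + _ _; apply: le_trans; rewrite -pb mulr_suml.
  apply: ler_sum => i _; have /andP[r0 r1] := r01 i.
  by rewrite ler_wpM2r// ler_piMr.
pose u i := a' i - \sum_j q i j; pose v j := b' j - \sum_i q i j.
have u0 i : 0 <= u i by rewrite subr_ge0.
have v0 j : 0 <= v j by rewrite subr_ge0.
pose t := \sum_i u i.
have tv : t = \sum_j v j.
  by rewrite /t /u /v !sumrB ab' exchange_big.
have t0 : 0 <= t by apply: sumr_ge0.
(* If [t = 0] the quotient is the default 0, but then every [u i] vanishes as well. *)
have u_t i : u i * t / t = u i.
  have [tz|tn0] := eqVneq t 0; last by rewrite mulfK.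
  suff -> : u i = 0 by rewrite !mul0r.
  by move/eqP: tz; rewrite psumr_eq0// => /allP/(_ i (mem_index_enum _))/eqP.
have v_t j : v j * t / t = v j.
  have [tz|tn0] := eqVneq t 0; last by rewrite mulfK.
  suff -> : v j = 0 by rewrite !mul0r.
  by move: tz; rewrite tv => /eqP; rewrite psumr_eq0// => /allP/(_ j (mem_index_enum _))/eqP.
exists (fun i j => q i j + u i * v j / t).
  split => [i j|i|j].
  - by rewrite addr_ge0// divr_ge0// mulr_ge0.
  - rewrite big_split/= -mulr_suml -mulr_sumr -tv u_t.
    by rewrite /u addrC subrK.
  - rewrite big_split/= (_ : \sum_i u i * v j / t = v j).
      by rewrite /v addrC subrK.
    by rewrite -!mulr_suml -/t (mulrC t) v_t.
have t_le : t <= \sum_i `|a i - a' i| + \sum_j `|b j - b' j|.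
  have h1 : \sum_i (a' i - `|a i - a' i|) <= \sum_i \sum_j p i j * r i.
    by apply: ler_sum => i _; rewrite -mulr_suml pa; case: (hr i).
  have h2 : \sum_j (b j - `|b j - b' j|) <= \sum_i \sum_j p i j * s j.
    by rewrite exchange_big/=; apply: ler_sum => j _; rewrite -mulr_suml pb; case: (hs j).
  (* From [(1 - r) (1 - s) >= 0] one gets [r s >= r + s - 1]. Summed against [p], with the equal
     total masses of [a] and [b] cancelling, this bounds the missing mass by the two distances. *)
  have h3 : \sum_i \sum_j (p i j * r i + p i j * s j - p i j) <= \sum_i \sum_j q i j.
    apply: ler_sum => i _; apply: ler_sum => j _; rewrite /q.
    have /andP[r0 r1] := r01 i; have /andP[s0 s1] := s01 j.
    rewrite -subr_ge0 (_ : _ - _ = p i j * ((1 - r i) * (1 - s j))); last by ring.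
    by rewrite !mulr_ge0// subr_ge0.
  move: h3; under eq_bigr do rewrite sumrB big_split/= pa.
  rewrite sumrB big_split/=; move: h1 h2; rewrite !sumrB /t /u sumrB.
  have := dcoupling_sum pab.
  lra.
have cost_uv : \sum_i \sum_j C i j * (u i * v j / t) <= K * t.
  apply: (@le_trans _ _ (\sum_i \sum_j K * (u i * v j / t))).
    apply: ler_sum => i _; apply: ler_sum => j _; rewrite ler_wpM2r//.
      by rewrite divr_ge0// mulr_ge0.
    by case/andP: (CK i j).
  under eq_bigr do rewrite -mulr_sumr -mulr_suml -mulr_sumr -tv u_t.
  by rewrite -mulr_sumr.
apply: (@le_trans _ _ (dcost C p + K * t)); last by rewrite lerD2l ler_wpM2l.
apply: le_trans (lerD (lexx (dcost C p)) cost_uv); rewrite /dcost -big_split/=.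
apply: ler_sum => i _; rewrite -big_split/=; apply: ler_sum => j _.
by rewrite mulrDr lerD2r ler_wpM2l//; case/andP: (CK i j).
Qed.

End discrete_coupling.

(** * Block couplings *)

Section label_integral.
Context {R : realType} d {T : measurableType d} (P : probability T R).

Lemma measurable_label_fun (I : finType) (h : T -> I) (phi : I -> R) :
  (forall i, measurable (h @^-1` [set i])) ->
  measurable_fun setT ((fun x => (phi (h x))%:E) : T -> \bar R).
Proof.
by move=> mh _ Y mY; rewrite setTI; exact: (measurable_label ((EFin \o phi) @^-1` Y)).
Qed.

Lemma integral_label (I : finType) (h : T -> I) (phi : I -> R) :
  (forall i, measurable (h @^-1` [set i])) -> (forall i, 0 <= phi i) ->
  (\int[P]_x (phi (h x))%:E = (\sum_i phi i * prob P (h @^-1` [set i]))%:E)%E.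
Proof.
move=> mh phi0.
under eq_integral => x _.
  rewrite (_ : (phi (h x))%:E =
      (\sum_i (phi i)%:E * (\1_(h @^-1` [set i]) x)%:E)%E); last first.
    rewrite (bigD1 (h x))//= indicE mem_set//= mule1 big1 ?adde0// => i ih.
    by rewrite indicE memNset ?mule0//= => /esym/eqP; apply/negP.
  over.
have mI i : measurable_fun setT ((fun x => (\1_(h @^-1` [set i]) x)%:E) : T -> \bar R).
  by apply/measurable_EFinP; exact: measurable_indic.
rewrite ge0_integral_sum//=; last 2 first.
- by move=> i; apply: emeasurable_funM => //; exact: measurable_cst.
- by move=> i x _; rewrite mule_ge0// lee_fin.
rewrite -sumEFin; apply: eq_bigr => i _.
rewrite ge0_integralZl_EFin//=.
by rewrite integral_indic// setIT EFinM -probE.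
Qed.

Lemma integral_label2 (I J : finType) (h : T -> I) (l : T -> J) (C : I -> J -> R) :
  (forall i, measurable (h @^-1` [set i])) -> (forall i, measurable (l @^-1` [set i])) ->
  (forall i j, 0 <= C i j) ->
  (\int[P]_x (C (h x) (l x))%:E =
   (dcost C (fun i j => prob P (h @^-1` [set i] `&` l @^-1` [set j])))%:E)%E.
Proof.
move=> mh ml C0.
have E i j : (fun x => (h x, l x)) @^-1` [set (i, j)] = h @^-1` [set i] `&` l @^-1` [set j].
  by apply/seteqP; split => x /=; [move=> [-> ->]|move=> [-> ->]].
rewrite (@integral_label _ (fun x => (h x, l x)) (fun z => C z.1 z.2))//.
  rewrite /dcost pair_big/=; congr (_%:E); apply: eq_bigr => -[i j] _ /=.
  by rewrite E.
by move=> [i j]; rewrite E; exact: measurableI.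
Qed.

Lemma law_dcoupling (I J : finType) (h : T -> I) (l : T -> J) :
  (forall i, measurable (h @^-1` [set i])) -> (forall i, measurable (l @^-1` [set i])) ->
  dcoupling (fun i => prob P (h @^-1` [set i])) (fun j => prob P (l @^-1` [set j]))
    (fun i j => prob P (h @^-1` [set i] `&` l @^-1` [set j])).
Proof.
move=> mh ml; split => [i j|i|j]; first exact: prob_ge0.
  by rewrite -prob_partition.
by under eq_bigr do rewrite setIC; rewrite -prob_partition.
Qed.

End label_integral.

Lemma finite_sum_measure (R : realType) d (T : measurableType d) (I : finType)
    (m : I -> {measure set T -> \bar R}) :
  exists m' : {measure set T -> \bar R}, forall A, m' A = (\sum_i m i A)%E.
Proof.
suff [m' m'E] : exists m' : {measure set T -> \bar R},
    forall A, m' A = (\sum_(i <- index_enum I) m i A)%E by exists m'.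
elim: (index_enum I) => [|i s [m' m'E]].
  by exists mzero => A; rewrite big_nil.
exists (measure_add (m i) m') => A; rewrite big_cons -m'E; exact: measure_addE.
Qed.

Section block.
Context {R : realType} d d' {S : measurableType d} {T : measurableType d'}.
Variables (M : probability S R) (N : probability T R).

(* On the block [al = i, be = j] the coupling is a multiple of [M \x N]; a block
   of [M \x N]-mass 0 gets the factor [p i j / 0 = 0], and there [p i j = 0]. *)
Lemma block_coupling (I J : finType) (al : S -> I) (be : T -> J) (p : I -> J -> R) :
  (forall i, measurable (al @^-1` [set i])) -> (forall j, measurable (be @^-1` [set j])) ->
  dcoupling (fun i => prob M (al @^-1` [set i])) (fun j => prob N (be @^-1` [set j])) p ->
  exists2 gam : probability (S * T)%type R, coupled M N gam &
    forall i j, prob gam (al @^-1` [set i] `*` be @^-1` [set j]) = p i j.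
Proof.
move=> mal mbe [p0 pa pb].
pose a i := prob M (al @^-1` [set i]); pose b j := prob N (be @^-1` [set j]).
have a0 i : 0 <= a i by exact: prob_ge0.
have b0 j : 0 <= b j by exact: prob_ge0.
have w0 i j : 0 <= p i j / (a i * b j) by rewrite divr_ge0// mulr_ge0.
have mE (z : I * J) : measurable (al @^-1` [set z.1] `*` be @^-1` [set z.2]).
  exact: measurableX.
pose m (z : I * J) : {measure set (S * T) -> \bar R} :=
  mscale (NngNum (w0 z.1 z.2)) (mrestr (M \x N)%E (mE z)).
have [m' m'E] := finite_sum_measure m.
have m'X A B : measurable A -> measurable B -> m' (A `*` B) =
    (\sum_i \sum_j p i j / (a i * b j) *
      (prob M (A `&` al @^-1` [set i]) * prob N (B `&` be @^-1` [set j])))%:E.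
  move=> mA mB; rewrite m'E pair_big -sumEFin; apply: eq_bigr => -[i j] _ /=.
  transitivity ((p i j / (a i * b j))%:E * (M \x N)
      ((A `*` B) `&` (al @^-1` [set i] `*` be @^-1` [set j])))%E; first by [].
  have mAi : measurable (A `&` al @^-1` [set i]) by exact: measurableI.
  have mBj : measurable (B `&` be @^-1` [set j]) by exact: measurableI.
  by rewrite -setXI product_measure1E// !EFinM -(probE M mAi) -(probE N mBj).
have p_a i j : a i = 0 -> p i j = 0.
  move=> ai0; have := pa i; rewrite -/(a i) ai0 => /eqP; rewrite psumr_eq0//.
  by move=> /allP/(_ j (mem_index_enum _))/eqP.
have p_b i j : b j = 0 -> p i j = 0.
  move=> bj0; have := pb j; rewrite -/(b j) bj0 => /eqP; rewrite psumr_eq0//.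
  by move=> /allP/(_ i (mem_index_enum _))/eqP.
have M0 A i : measurable A -> a i = 0 -> prob M (A `&` al @^-1` [set i]) = 0.
  move=> mA ai0; apply/eqP; rewrite eq_le prob_ge0 andbT -ai0.
  by apply: le_prob => //; exact: measurableI.
have N0 B j : measurable B -> b j = 0 -> prob N (B `&` be @^-1` [set j]) = 0.
  move=> mB bj0; apply/eqP; rewrite eq_le prob_ge0 andbT -bj0.
  by apply: le_prob => //; exact: measurableI.
have mS A : measurable A -> m' (A `*` setT) = M A.
  move=> mA; rewrite m'X// probE// (prob_partition M mal mA); congr (_%:E).
  apply: eq_bigr => i _; have [ai0|ai0] := eqVneq (a i) 0.
    by rewrite M0// big1// => j _; rewrite mul0r mulr0.
  transitivity (\sum_j p i j / a i * prob M (A `&` al @^-1` [set i])).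
    apply: eq_bigr => j _; rewrite setTI -/(b j).
    have [bj0|bj0] := eqVneq (b j) 0; first by rewrite p_b// !mul0r.
    by field; apply/andP.
  by rewrite -!mulr_suml pa -/(a i) divff// mul1r.
have mT B : measurable B -> m' (setT `*` B) = N B.
  move=> mB; rewrite m'X// probE// (prob_partition N mbe mB); congr (_%:E).
  rewrite exchange_big/=; apply: eq_bigr => j _; have [bj0|bj0] := eqVneq (b j) 0.
    by rewrite N0// big1// => i _; rewrite !mulr0.
  transitivity (\sum_i p i j / b j * prob N (B `&` be @^-1` [set j])).
    apply: eq_bigr => i _; rewrite setTI -/(a i).
    have [ai0|ai0] := eqVneq (a i) 0; first by rewrite p_a// !mul0r.
    by field; apply/andP.
  by rewrite -!mulr_suml pb -/(b j) divff// mul1r.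
have [|gam gamE] := @measure_probability _ _ _ m'.
  by rewrite -setXTT mS// probability_setT.
exists gam.
  by split => [A mA|B mB]; rewrite /prob gamE ?mS ?mT.
move=> i j; apply: EFin_inj; rewrite -probE; last exact: measurableX.
rewrite gamE m'X//; congr (_%:E); rewrite (bigD1 i)//= (bigD1 j)//=.
rewrite !setIid -/(a i) -/(b j) big1 ?addr0; last first.
  move=> j' jj'; rewrite [X in _ * (_ * X)](_ : _ = 0) ?mulr0//.
  rewrite (_ : _ `&` _ = set0) ?prob_set0//; apply/seteqP; split => // t [/= -> /esym/eqP].
  by apply/negP.
rewrite big1 ?addr0; last first.
  move=> i' ii'; apply: big1 => j' _.
  rewrite (_ : _ `&` al @^-1` _ = set0) ?prob_set0 ?mul0r ?mulr0//.
  by apply/seteqP; split => // t [/= -> /esym/eqP]; apply/negP.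
have [ai0|ai0] := eqVneq (a i) 0; first by rewrite p_a// !mul0r.
have [bj0|bj0] := eqVneq (b j) 0; first by rewrite p_b// !mul0r.
by rewrite divfK// mulf_neq0.
Qed.

End block.

(** * Lower semicontinuous costs as suprema over rectangles *)

Section rect_approx.
Context {R : realType} {X Y : ptopologicalType}.

(* [c] is the supremum of the functions [r i * 1_(U i `*` V i)]. *)
Definition rect_approx (c : X -> Y -> R) (U : nat -> set X) (V : nat -> set Y)
    (r : nat -> R) : Prop :=
  [/\ forall i, open (U i), forall i, open (V i), forall i, 0 <= r i,
      forall i x y, U i x -> V i y -> r i <= c x y
    & forall x y a, a < c x y -> exists i, [/\ U i x, V i y & a < r i]].

(** The index decodes to two base sets and a rational. A triple whose rational is negative, or not a
    lower bound of [c] on the rectangle, is neutralized by making [U i] empty. *)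
Lemma lsc_rect_approx (c : X -> Y -> R) (B : nat -> set X) (B' : nat -> set Y) :
  base_seq B -> base_seq B' -> (forall x y, 0 <= c x y) ->
  lower_semicontinuous (fun z : X * Y => (c z.1 z.2)%:E) ->
  exists U V r, rect_approx c U V r.
Proof.
move=> [oB hB] [oB' hB'] c0 lc.
pose good (m n : nat) (q : rat) :=
  0 <= (ratr q : R) /\ forall x y, B m x -> B' n y -> ratr q <= c x y.
pose dec i := @unpickle (nat * nat * rat)%type i.
pose U i := if dec i is Some (m, n, q) then
  [set x | B m x /\ good m n q] else set0.
pose V i := if dec i is Some (m, n, q) then B' n else set0.
pose r i : R := if dec i is Some (m, n, q) then Num.max 0 (ratr q) else 0.
exists U, V, r; split.
- move=> i; rewrite /U; case: (dec i) => [[[m n] q]|]; last exact: open0.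
  have [g|g] := pselect (good m n q).
    by rewrite (_ : [set _ | _] = B m)//; apply/seteqP; split => x // [].
  by rewrite (_ : [set _ | _] = set0)//; [exact: open0|apply/seteqP; split => x // []].
- by move=> i; rewrite /V; case: (dec i) => [[[m n] q]|]; [exact: oB'|exact: open0].
- by move=> i; rewrite /r; case: (dec i) => [[[m n] q]|//]; rewrite le_max lexx.
- move=> i x y; rewrite /U /V /r; case: (dec i) => [[[m n] q]|//] [Bx [q0 g]] B'y.
  by rewrite ge_max c0 g.
- move=> x y a ac.
  have [q [q0 aq Gq]] : exists q : rat, [/\ 0 <= (ratr q : R), a < ratr q
      & nbhs (x, y) [set z | (ratr q : R) <= c z.1 z.2]].
    (* At a zero of [c] there is no nonnegative rational strictly below the value, but [q = 0] is a
       lower bound everywhere. *)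
    have [c00|c00] := eqVneq (c x y) 0.
      exists 0; rewrite rmorph0 lexx -c00; split => //.
      by rewrite c00; apply: filterE => z /=; exact: c0.
    have cgt0 : 0 < c x y by rewrite lt_neqAle eq_sym c00 c0.
    have mx : Num.max 0 a < c x y by rewrite gt_max cgt0.
    have [q] := rat_in_itvoo mx; rewrite in_itv/= gt_max => /andP[/andP[q0 aq] qc].
    exists q; split => //; first exact: ltW.
    have [|W hW Wq] := lc (x, y) (ratr q); first by rewrite lte_fin.
    by apply: filterS hW => z /Wq; rewrite lte_fin => /ltW.
  have [[W W'] [/= xW yW'] WW'] := Gq.
  have [m Bx BW] := hB x W xW; have [n B'y BW'] := hB' y W' yW'.
  have g : good m n q.
    by split => // x' y' /BW Wx' /BW' Wy'; exact: (WW' (x', y')).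
  by exists (pickle (m, n, q)); rewrite /U /V /r /dec pickleK; split => //; rewrite lt_max aq orbT.
Qed.

End rect_approx.

(** Labels the atoms of the algebra generated by the first [n] sets. The truncated costs and the
    finite problems see a point only through its mark. *)
Definition mark (X : Type) (U : nat -> set X) (n : nat) (x : X) : {ffun 'I_n -> bool} :=
  [ffun k : 'I_n => `[< U k x >]].

Lemma measurable_mark d (T : measurableType d) (U : nat -> set T) n i :
  (forall k, measurable (U k)) -> measurable (mark U n @^-1` [set i]).
Proof. by move=> mU; exact: measurable_ffun_label. Qed.

Section cutoff.
Context {R : realType} (r : nat -> R).
Hypothesis r0 : forall i, 0 <= r i.

(** Evaluated at marks, this is the supremum in [rect_approx] truncated to its first [n] terms. *)
Definition cutoff n (f g : {ffun 'I_n -> bool}) : R :=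
  \big[Num.max/0]_(k < n | f k && g k) r k.

Lemma cutoff_ge0 n (f g : {ffun 'I_n -> bool}) : 0 <= cutoff f g.
Proof. exact: bigmax_ge_id. Qed.

Definition cutoff_bound n : R := \big[Num.max/0]_(k < n) r k.

Lemma cutoff_bounded n (f g : {ffun 'I_n -> bool}) : 0 <= cutoff f g <= cutoff_bound n.
Proof.
rewrite cutoff_ge0; apply: bigmax_le => [|i _]; first exact: bigmax_ge_id.
exact: le_bigmax_cond.
Qed.

Lemma cutoff_mono (X Y : Type) (U : nat -> set X) (V : nat -> set Y) m n x y :
  (m <= n)%N -> cutoff (mark U m x) (mark V m y) <= cutoff (mark U n x) (mark V n y).
Proof.
move=> mn; apply: bigmax_le => [|i]; first exact: cutoff_ge0.
rewrite !ffunE => iUV.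
by apply: (bigmax_sup (widen_ord mn i)); rewrite ?ffunE.
Qed.

Context {X Y : ptopologicalType} (c : X -> Y -> R) (U : nat -> set X) (V : nat -> set Y).
Hypothesis cUV : rect_approx c U V r.

Lemma cutoff_le n x y : 0 <= c x y -> cutoff (mark U n x) (mark V n y) <= c x y.
Proof.
move=> c0; apply: bigmax_le => // i; rewrite !ffunE => /andP[/asboolP Ux /asboolP Vy].
by case: cUV => _ _ _ + _; apply.
Qed.

Lemma cutoff_cvg x y : 0 <= c x y ->
  (cutoff (mark U n x) (mark V n y))%:E @[n --> \oo] --> (c x y)%:E.
Proof.
move=> c0; apply: cvg_EFin; first exact: nearW.
apply/cvgrPdist_lt => e e0; have [_ _ _ _ h] := cUV.
have [|i [Ux Vy ri]] := h x y (c x y - e); first by rewrite ltrBlDr ltrDl.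
exists i.+1 => // n /= ilt.
rewrite ger0_norm ?subr_ge0 ?cutoff_le// ltrBlDr -ltrBlDl; apply: lt_le_trans ri _.
apply: (bigmax_sup (Ordinal ilt)) => //; rewrite !ffunE.
by apply/andP; split; exact/asboolP.
Qed.

End cutoff.

Section cost_measurable.
Context {R : realType} {X Y : ptopologicalType} (c : X -> Y -> R).
Context (U : nat -> set X) (V : nat -> set Y) (r : nat -> R).
Hypothesis cUV : rect_approx c U V r.
Hypothesis c0 : forall x y, 0 <= c x y.
Context d {Om : measurableType d} (s : Om -> X) (t : Om -> Y).
Hypotheses (ms : measurable_fun setT (s : Om -> borel X))
  (mt : measurable_fun setT (t : Om -> borel Y)).

Lemma measurable_markX n i : measurable ((mark U n \o s) @^-1` [set i]).
Proof.
rewrite comp_preimage -[X in measurable X]setTI; apply: ms => //.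
by apply: measurable_mark => k; apply: borel_open; case: cUV.
Qed.

Lemma measurable_markY n i : measurable ((mark V n \o t) @^-1` [set i]).
Proof.
rewrite comp_preimage -[X in measurable X]setTI; apply: mt => //.
by apply: measurable_mark => k; apply: borel_open; case: cUV.
Qed.

Lemma measurable_cutoff n : measurable_fun setT
  ((fun w => (cutoff r (mark U n (s w)) (mark V n (t w)))%:E) : Om -> \bar R).
Proof.
apply: (measurable_label_fun (h := fun w => (mark U n (s w), mark V n (t w)))
  (fun z => cutoff r z.1 z.2)) => -[i j].
rewrite (_ : _ @^-1` _ = (mark U n \o s) @^-1` [set i] `&` (mark V n \o t) @^-1` [set j]).
  by apply: measurableI; [exact: measurable_markX|exact: measurable_markY].
by apply/seteqP; split => w /=; [move=> [-> ->]|move=> [-> ->]].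
Qed.

Lemma measurable_cost : measurable_fun setT ((fun w => (c (s w) (t w))%:E) : Om -> \bar R).
Proof.
apply: (emeasurable_fun_cvg _ _ measurable_cutoff) => w _.
exact: (cutoff_cvg cUV).
Qed.

Lemma integral_cutoff (P : probability Om R) n :
  (\int[P]_w (cutoff r (mark U n (s w)) (mark V n (t w)))%:E =
   (dcost (@cutoff _ r n) (fun i j => prob P
     ((mark U n \o s) @^-1` [set i] `&` (mark V n \o t) @^-1` [set j])))%:E)%E.
Proof.
apply: (@integral_label2 _ _ _ P _ _ (mark U n \o s) (mark V n \o t)) => [i|i|i j].
- exact: measurable_markX.
- exact: measurable_markY.
- exact: cutoff_ge0.
Qed.

Lemma le_integral_cutoff (P : probability Om R) n :
  (\int[P]_w (cutoff r (mark U n (s w)) (mark V n (t w)))%:E <=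
   \int[P]_w (c (s w) (t w))%:E)%E.
Proof.
apply: ge0_le_integral => //.
- by move=> w _; rewrite lee_fin cutoff_ge0.
- exact: measurable_cutoff.
- exact: measurable_cost.
- by move=> w _; rewrite lee_fin cutoff_le.
Qed.

Lemma integral_cost_le (P : probability Om R) (L : \bar R) :
  (forall n, \int[P]_w (cutoff r (mark U n (s w)) (mark V n (t w)))%:E <= L)%E ->
  (\int[P]_w (c (s w) (t w))%:E <= L)%E.
Proof.
move=> hL; pose f n w := (cutoff r (mark U n (s w)) (mark V n (t w)))%:E.
have f0 n w : setT w -> (0 <= f n w)%E by move=> _; rewrite lee_fin cutoff_ge0.
have fnd w : setT w -> {homo f ^~ w : m n / (m <= n)%N >-> (m <= n)%E}.
  by move=> _ m n mn; rewrite lee_fin cutoff_mono.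
rewrite (_ : (\int[P]_w (c (s w) (t w))%:E = limn (fun n => \int[P]_w f n w))%E).
  apply: lime_le; last exact: nearW.
  apply: ereal_nondecreasing_is_cvgn => m n mn; apply: ge0_le_integral => //.
  - by move=> w; exact: f0.
  - exact: measurable_cutoff.
  - exact: measurable_cutoff.
  - by move=> w Tw; exact: fnd.
rewrite -monotone_convergence//; last by move=> n; exact: measurable_cutoff.
apply: eq_integral => w _; apply/esym/cvg_lim => //.
exact: (cutoff_cvg cUV).
Qed.

End cost_measurable.

Lemma cvg_fsum (R : realType) (T : Type) (G : set_system T) (I : finType)
    (f : I -> T -> R) (l : I -> R) : Filter G ->
  (forall i, f i @ G --> l i) -> \sum_i f i x @[x --> G] --> \sum_i l i.
Proof.
move=> FG fl; elim: (index_enum I) => [|i s ih].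
  by rewrite big_nil; under eq_fun do rewrite big_nil; exact: cvg_cst.
by rewrite big_cons; under eq_fun do rewrite big_cons; exact: cvgD.
Qed.

Section limit_cost.
Context {R : realType} {X Y : ptopologicalType} (c : X -> Y -> R).
Context (U : nat -> set X) (V : nat -> set Y) (r : nat -> R).
Hypothesis cUV : rect_approx c U V r.
Hypothesis c0 : forall x y, 0 <= c x y.
Context d d' {S : measurableType d} {T : measurableType d'} (s : S -> X) (t : T -> Y).
Hypotheses (ms : measurable_fun setT (s : S -> borel X))
  (mt : measurable_fun setT (t : T -> borel Y)).

(** In the hypothesis the coupling and the level of the cutoff move together. They are decoupled by
    fixing a level [m], whose cutoff lies below that of every level [n >= m]. At fixed [m] the
    integral is a finite combination of masses of rectangles and passes to the limit; then [m]
    grows. *)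
Lemma limit_cost (gam : nat -> probability (S * T)%type R) (g : probability (S * T)%type R)
    (G : set_system nat) (L : \bar R) (e : nat -> R) :
  ProperFilter G -> G --> \oo ->
  (forall A B, measurable A -> measurable B ->
    prob (gam n) (A `*` B) @[n --> G] --> prob g (A `*` B)) ->
  e @ \oo --> (0 : R) -> (0 <= L)%E ->
  (forall n, \int[gam n]_z (cutoff r (mark U n (s z.1)) (mark V n (t z.2)))%:E
     <= L + (e n)%:E)%E ->
  (\int[g]_z (c (s z.1) (t z.2))%:E <= L)%E.
Proof.
move=> PG Goo hg e0; case: L => [L|_ _|]; [|exact: leey|by rewrite leeNy_eq].
move=> _ hL; have ms1 : measurable_fun setT ((s \o fst) : S * T -> borel X).
  exact: measurableT_comp.
have mt2 : measurable_fun setT ((t \o snd) : S * T -> borel Y).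
  exact: measurableT_comp.
apply: (integral_cost_le cUV c0 ms1 mt2) => m.
pose ci n (P : probability (S * T)%type R) := dcost (@cutoff _ r n) (fun i j => prob P
      ((mark U n \o s) @^-1` [set i] `*` (mark V n \o t) @^-1` [set j])).
have E (P : probability (S * T)%type R) n :
    (\int[P]_z (cutoff r (mark U n (s z.1)) (mark V n (t z.2)))%:E = (ci n P)%:E)%E.
  exact: (integral_cutoff cUV ms1 mt2).
rewrite [leLHS]E lee_fin; apply/ler_addgt0Pr => eps eps0.
have cvg_ci : ci m (gam n) @[n --> G] --> ci m g.
  apply: cvg_fsum => i; apply: cvg_fsum => j; apply: cvgM; first exact: cvg_cst.
  apply: hg.
    exact: (measurable_markX cUV ms).
  exact: (measurable_markY cUV mt).
apply: (cvgr_to_le cvg_ci); apply: Goo; near=> n.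
apply: (@le_trans _ _ (ci n (gam n))).
  rewrite -lee_fin -!E; apply: ge0_le_integral => //.
  - by move=> w _; rewrite lee_fin cutoff_ge0.
  - exact: (measurable_cutoff cUV ms1 mt2).
  - exact: (measurable_cutoff cUV ms1 mt2).
  - move=> w _; rewrite lee_fin; apply: cutoff_mono.
    by near: n; exists m.
have := hL n; rewrite E -EFinD lee_fin => /le_trans; apply.
rewrite lerD2l; near: n; exact: (cvgr_le _ e0 _ eps0).
Unshelve. all: by end_near. Qed.

End limit_cost.

(** * Wasserstein costs as limits of finite problems *)

Section dopt.
Context {R : realType} {I J : finType} (C : I -> J -> R).
Hypothesis C0 : forall i j, 0 <= C i j.

Definition dopt (a : I -> R) (b : J -> R) : R :=
  inf [set dcost C p | p in dcoupling a b].

Lemma dcost_ge0 p : (forall i j, 0 <= p i j) -> 0 <= dcost C p.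
Proof. by move=> p0; do 2 apply: sumr_ge0 => ? _; exact: mulr_ge0. Qed.

Lemma dopt_le a b p : dcoupling a b p -> dopt a b <= dcost C p.
Proof.
move=> pab; apply: ge_inf; last by exists p.
by exists 0 => _ [q [q0 _ _] <-]; exact: dcost_ge0.
Qed.

Lemma dopt_adherent a b (e : R) : (exists p, dcoupling a b p) -> 0 < e ->
  exists2 p, dcoupling a b p & dcost C p < dopt a b + e.
Proof.
move=> [p pab] e0; have [|_ [q qab <-] qe] :=
  @inf_adherent _ _ e e0 (_ : has_inf [set dcost C p | p in dcoupling a b]).
  split; first by exists (dcost C p), p.
  by exists 0 => _ [q [q0 _ _] <-]; exact: dcost_ge0.
by exists q.
Qed.

Lemma dopt_ge0 a b : (exists p, dcoupling a b p) -> 0 <= dopt a b.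
Proof.
move=> [p pab]; apply: lb_le_inf; first by exists (dcost C p), p.
by move=> _ [q [q0 _ _] <-]; exact: dcost_ge0.
Qed.

Lemma product_dcoupling (a : I -> R) (b : J -> R) :
  (forall i, 0 <= a i) -> (forall j, 0 <= b j) ->
  \sum_i a i = 1 -> \sum_j b j = 1 -> exists p, dcoupling a b p.
Proof.
move=> a0 b0 a1 b1; exists (fun i j => a i * b j); split => [i j|i|j].
- exact: mulr_ge0.
- by rewrite -mulr_sumr b1 mulr1.
- by rewrite -mulr_suml a1 mul1r.
Qed.

End dopt.

(** By second countability an open set of the product is a countable union of base rectangles, so
    every Borel set of the product belongs to the product sigma-algebra. *)
Lemma measurable_prod_borel (X Y : ptopologicalType) (B : nat -> set X) (B' : nat -> set Y) :
  base_seq B -> base_seq B' ->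
  measurable_fun setT (id : borel X * borel Y -> borel (X * Y)).
Proof.
move=> [oB hB] [oB' hB'].
apply: (@measurability _ _ (borel X * borel Y)%type (borel (X * Y)) setT id
  (@open (X * Y)%type) erefl).
move=> _ [G oG <-]; rewrite setTI preimage_id.
rewrite (_ : G = \bigcup_(k in [set k : nat * nat | B k.1 `*` B' k.2 `<=` G])
    (B k.1 `*` B' k.2)); last first.
  apply/seteqP; split=> [[x y] Gxy|z [k /= kG]]; last exact: kG.
  have [[A A'] [/= xA yA'] AG] : nbhs (x, y) G by exact: open_nbhs_nbhs.
  have [m Bx BA] := hB x A xA; have [n B'y BA'] := hB' y A' yA'.
  by exists (m, n) => //= -[x' y'] [/= /BA Ax' /BA' Ay']; exact: (AG (x', y')).
rewrite bigcup_mkcond; apply: countable_bigcupT_measurable => // k.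
by case: ifP => // _; apply: measurableX; exact: borel_open.
Qed.

Lemma borel_fst (X Y : ptopologicalType) :
  measurable_fun setT (fst : borel (X * Y) -> borel X).
Proof. by apply: continuous_borel => z; exact: cvg_fst. Qed.

Lemma borel_snd (X Y : ptopologicalType) :
  measurable_fun setT (snd : borel (X * Y) -> borel Y).
Proof. by apply: continuous_borel => z; exact: cvg_snd. Qed.

Section wasserstein_discrete.
Context {R : realType} {X Y : ptopologicalType} (c : X -> Y -> R).
Context (U : nat -> set X) (V : nat -> set Y) (r : nat -> R).
Hypothesis cUV : rect_approx c U V r.
Hypothesis c0 : forall x y, 0 <= c x y.
Hypotheses (pX : polish_space R X) (pY : polish_space R Y).

Definition mark_law (Z : ptopologicalType) (A : nat -> set Z)
    (M : probability (borel Z) R) n (i : {ffun 'I_n -> bool}) : R :=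
  prob M (mark A n @^-1` [set i]).

(** The transport problem for the cost truncated at level [n], reduced to the laws of the marks: a
    coupling projects to a matrix, and [block_coupling] lifts a matrix back to a coupling. *)
Definition discrete_wasserstein (M : probability (borel X) R)
    (N : probability (borel Y) R) n : R :=
  dopt (@cutoff _ r n) (@mark_law _ U M n) (@mark_law _ V N n).

Let oU i : open (U i). Proof. by case: cUV. Qed.
Let oV i : open (V i). Proof. by case: cUV. Qed.

Lemma mark_law_sum (Z : ptopologicalType) (A : nat -> set Z)
    (M : probability (borel Z) R) n : (forall i, open (A i)) ->
  \sum_i @mark_law _ A M n i = 1.
Proof.
move=> oA; rewrite -(prob_setT M).
have mA (i : {ffun 'I_n -> bool}) : measurable (mark A n @^-1` [set i] : set (borel Z)).
  by apply: measurable_mark => k; exact: borel_open.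
rewrite (prob_partition M mA measurableT); apply: eq_bigr => i _.
by rewrite setTI.
Qed.

Lemma mark_law_dcoupling (M : probability (borel X) R) (N : probability (borel Y) R) n :
  exists p, dcoupling (@mark_law _ U M n) (@mark_law _ V N n) p.
Proof.
apply: product_dcoupling => [i|i||]; try exact: prob_ge0.
- exact: mark_law_sum.
- exact: mark_law_sum.
Qed.

Variables (M : probability (borel X) R) (N : probability (borel Y) R).

Section couple.
Context d {Om : measurableType d} (P : probability Om R) (s : Om -> X) (t : Om -> Y).
Hypotheses (ms : measurable_fun setT (s : Om -> borel X))
  (mt : measurable_fun setT (t : Om -> borel Y)).
Hypotheses (sM : forall A : set (borel X), measurable A -> prob P (s @^-1` A) = prob M A)
  (tN : forall B : set (borel Y), measurable B -> prob P (t @^-1` B) = prob N B).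

Lemma discrete_wasserstein_cutoff n : ((discrete_wasserstein M N n)%:E <=
  \int[P]_w (cutoff r (mark U n (s w)) (mark V n (t w)))%:E)%E.
Proof.
rewrite (integral_cutoff cUV ms mt) lee_fin; apply: dopt_le.
  by move=> i j; exact: cutoff_ge0.
have := @law_dcoupling _ _ _ P _ _ (mark U n \o s) (mark V n \o t)
  (measurable_markX cUV ms (n := n)) (measurable_markY cUV mt (n := n)).
rewrite (_ : (fun i => prob P ((mark U n \o s) @^-1` [set i])) = @mark_law _ U M n).
  rewrite (_ : (fun j => prob P ((mark V n \o t) @^-1` [set j])) = @mark_law _ V N n)//.
  apply/funext => j; rewrite comp_preimage tN//.
  by apply: measurable_mark => k; exact: borel_open.
apply/funext => i; rewrite comp_preimage sM//.
by apply: measurable_mark => k; exact: borel_open.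
Qed.

Lemma discrete_wasserstein_le n : ((discrete_wasserstein M N n)%:E <=
  \int[P]_w (c (s w) (t w))%:E)%E.
Proof.
apply: le_trans (discrete_wasserstein_cutoff n) _.
exact: (le_integral_cutoff cUV).
Qed.

End couple.

Lemma discrete_wasserstein_coupling n (e : R) : 0 < e ->
  exists2 gam : probability (borel X * borel Y)%type R, coupled M N gam &
    (\int[gam]_z (cutoff r (mark U n z.1) (mark V n z.2))%:E <=
     (discrete_wasserstein M N n + e)%:E)%E.
Proof.
move=> e0.
have mU (i : {ffun 'I_n -> bool}) : measurable (mark U n @^-1` [set i] : set (borel X)).
  by apply: measurable_mark => k; exact: borel_open.
have mV (i : {ffun 'I_n -> bool}) : measurable (mark V n @^-1` [set i] : set (borel Y)).
  by apply: measurable_mark => k; exact: borel_open.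
have C0 i j : 0 <= @cutoff _ r n i j by exact: cutoff_ge0.
have [p pMN pe] := dopt_adherent C0 (mark_law_dcoupling M N n) e0.
have [gam gMN gp] := block_coupling mU mV pMN.
exists gam => //; rewrite (integral_cutoff cUV measurable_fst measurable_snd) lee_fin.
apply: le_trans (ltW pe); rewrite le_eqVlt; apply/orP; left; apply/eqP.
by congr dcost; apply/funext => i; apply/funext => j; rewrite -gp.
Qed.

Lemma coupled_fst (d d' : measure_display) (S : measurableType d) (T : measurableType d')
    (P : probability S R) (Q : probability T R) gam : coupled P Q gam ->
  forall A, measurable A -> prob gam (fst @^-1` A) = prob P A.
Proof. by move=> [h _] A mA; rewrite -h// -setXT. Qed.

Lemma coupled_snd (d d' : measure_display) (S : measurableType d) (T : measurableType d')
    (P : probability S R) (Q : probability T R) gam : coupled P Q gam ->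
  forall A, measurable A -> prob gam (snd @^-1` A) = prob Q A.
Proof. by move=> [_ h] A mA; rewrite -h// -setTX. Qed.

(** Marks of different levels have different types, so the comparison goes through an actual
    coupling, near-optimal at level [n] and tested against the smaller cutoff of level [m]. *)
Lemma discrete_wasserstein_mono m n : (m <= n)%N ->
  discrete_wasserstein M N m <= discrete_wasserstein M N n.
Proof.
move=> mn; apply/ler_addgt0Pr => e e0.
have [gam gMN ge] := discrete_wasserstein_coupling n e0.
rewrite -lee_fin; apply: le_trans ge.
apply: (le_trans (discrete_wasserstein_cutoff measurable_fst measurable_snd
  (coupled_fst gMN) (coupled_snd gMN) m)).
apply: ge0_le_integral => //.
- by move=> z _; rewrite lee_fin cutoff_ge0.
- exact: (measurable_cutoff cUV measurable_fst measurable_snd).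
- exact: (measurable_cutoff cUV measurable_fst measurable_snd).
- by move=> z _; rewrite lee_fin cutoff_mono.
Qed.

Lemma coupled_couplings (gam : probability (borel X * borel Y)%type R) :
  coupled M N gam -> exists2 pi : probability (borel (X * Y)) R,
    couplings M N pi &
    forall f : X * Y -> \bar R, measurable_fun setT (f : borel (X * Y) -> \bar R) ->
      (forall z, 0 <= f z)%E -> (\int[pi]_z f z = \int[gam]_z f z)%E.
Proof.
move=> gMN; have [B bB] := polish_base pX; have [B' bB'] := polish_base pY.
have mid := measurable_prod_borel bB bB'.
have [pi piE] := pushforward_probability gam mid.
exists pi.
  split => A mA; rewrite /pushforward piE /pushforward preimage_id.
    rewrite probE; last by rewrite -[X in measurable X]setTI; exact: measurable_fst.
    by rewrite (coupled_fst gMN)// -probE.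
  rewrite probE; last by rewrite -[X in measurable X]setTI; exact: measurable_snd.
  by rewrite (coupled_snd gMN)// -probE.
move=> f mf f0; rewrite piE (ge0_integral_pushforward mid)//.
Qed.

Lemma wasserstein_ge n : ((discrete_wasserstein M N n)%:E <= wasserstein c M N)%E.
Proof.
apply: le_ereal_inf_tmp => _ [pi [piM piN] <-].
apply: (discrete_wasserstein_le (@borel_fst X Y) (@borel_snd X Y)) => A mA; rewrite /prob.
  by rewrite -piM.
by rewrite -piN.
Qed.

(** Couplings that are optimal at level [n] up to [1/(n+1)] have a limit, which is a coupling of the
    same marginals whose full cost is still at most [L]. *)
Lemma wasserstein_le (L : \bar R) :
  (forall n, (discrete_wasserstein M N n)%:E <= L)%E -> (wasserstein c M N <= L)%E.
Proof.
move=> hL; have L0 : (0 <= L)%E.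
  apply: le_trans (hL 0%N); rewrite lee_fin; apply: dopt_ge0.
    by move=> i j; exact: cutoff_ge0.
  exact: mark_law_dcoupling.
have /choice[gam hg] : forall n, exists gam : probability (borel X * borel Y)%type R,
    coupled M N gam /\
    (\int[gam]_z (cutoff r (mark U n z.1) (mark V n z.2))%:E <=
     (discrete_wasserstein M N n + n.+1%:R^-1)%:E)%E.
  move=> n; have [|gam h1 h2] := @discrete_wasserstein_coupling n n.+1%:R^-1.
    by rewrite invr_gt0.
  by exists gam.
have [g gMN [G [PG Goo hg']]] := coupling_limit pY (fun n => proj1 (hg n)).
have [pi piMN piE] := coupled_couplings gMN.
apply: (@le_trans _ _ (\int[pi]_z (c z.1 z.2)%:E)%E).
  by apply: ereal_inf_lbound; exists pi.
have mc := measurable_cost cUV c0 (@borel_fst X Y) (@borel_snd X Y).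
rewrite piE//; last by move=> z; rewrite lee_fin.
apply: (@limit_cost _ _ _ _ _ _ _ cUV c0 _ _ (borel X) (borel Y) id id
  (@measurable_id _ _ _) (@measurable_id _ _ _) _ _ _ _ harmonic PG Goo hg') => //.
  exact: cvg_harmonic.
by move=> n; case: (hg n) => _ /le_trans; apply; rewrite EFinD leeD2r.
Qed.

Lemma cvg_discrete_wasserstein :
  (discrete_wasserstein M N n)%:E @[n --> \oo] --> wasserstein c M N.
Proof.
rewrite (_ : wasserstein c M N = ereal_sup (range (fun n => (discrete_wasserstein M N n)%:E))).
  by apply: ereal_nondecreasing_cvgn => m n mn; rewrite lee_fin discrete_wasserstein_mono.
apply/eqP; rewrite eq_le; apply/andP; split.
  by apply: wasserstein_le => n; apply: ereal_sup_ubound; exists n.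
by apply: ge_ereal_sup => _ [n _ <-]; exact: wasserstein_ge.
Qed.

End wasserstein_discrete.

(** * Families of laws over a base *)

(** The label records, for each [i], which thresholds [k * e] with [k < K] lie below [f i x]. Since
    [K * e > 1] they exhaust [[0, 1]], so equal labels confine both values to one step of the
    grid. *)
Lemma grid_label (R : realType) d (T : measurableType d) (I : finType)
    (f : I -> T -> R) (e : R) : 0 < e ->
  (forall i, measurable_fun setT (f i)) -> (forall i x, 0 <= f i x <= 1) ->
  exists (L : finType) (rho : T -> L), (forall l, measurable (rho @^-1` [set l])) /\
    forall x y, rho x = rho y -> forall i, `|f i x - f i y| <= e.
Proof.
move=> e0 mf f01; have [K eK] : exists K : nat, 1 < K%:R * e.
  exists (Num.truncn e^-1).+1; rewrite -ltr_pdivrMr// mul1r.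
  exact: truncnS_gt.
pose A (z : I * 'I_K) := [set x | z.2%:R * e <= f z.1 x].
exists {ffun I * 'I_K -> bool}, (fun x => [ffun z => `[< A z x >]]); split.
  move=> l; apply: measurable_ffun_label => -[i k].
  rewrite (_ : A _ = f i @^-1` `[k%:R * e, +oo[%classic).
    by rewrite -[X in measurable X]setTI; apply: mf => //; exact: measurable_itv.
  by apply/seteqP; split => x /=; rewrite in_itv/= andbT.
suff half x y i : (forall z, A z y -> A z x) -> f i y - f i x <= e.
  move=> x y /ffunP xy i; have xyA z : A z x <-> A z y.
    by apply: asbool_eq_equiv; have := xy z; rewrite !ffunE.
  rewrite ler_norml half ?andbT; last by move=> z /xyA.
  by rewrite lerNl opprB half// => z /xyA.
move=> yx; rewrite leNgt; apply/negP; rewrite ltrBrDl => fxy.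
have fy0 : 0 <= f i y / e by rewrite divr_ge0 ?(ltW e0)//; case/andP: (f01 i y).
have /andP[] := truncn_itv fy0; set k := Num.truncn _ => ky yk.
have kK : (k < K)%N.
  rewrite -(ltr_nat R); apply: le_lt_trans ky _; rewrite ltr_pdivrMr//.
  by apply: le_lt_trans eK; case/andP: (f01 i y).
have /= kx := yx (i, Ordinal kK).
move: ky yk; rewrite ler_pdivlMr// ltr_pdivrMr// => /kx; rewrite /A/= => {}kx.
rewrite -natr1 mulrDl mul1r => /(lt_trans fxy); rewrite ltNge => /negP; apply.

by rewrite lerD2r.
Qed.

Section average.
Context {R : realType} d {T : measurableType d} (m : probability T R).

Lemma average_close (f : T -> R) (E : set T) (x e v : R) :
  measurable E -> measurable_fun setT f -> (forall q, 0 <= f q) -> 0 <= x -> 0 <= e ->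
  (forall q, E q -> `|f q - x| <= e) -> (v%:E = \int[m]_(q in E) (f q)%:E)%E ->
  `|v - prob m E * x| <= prob m E * e.
Proof.
move=> mE mf f0 x0 e0 fx vE.
have mfE : measurable_fun E ((fun q => (f q)%:E) : T -> \bar R).
  by apply/measurable_EFinP; exact: measurable_funS mf.
have mcst (a : R) : measurable_fun E ((fun q => a%:E) : T -> \bar R).
  exact: measurable_cst.
have icst (a : R) : (\int[m]_(q in E) a%:E = (prob m E * a)%:E)%E.
  by rewrite (integral_cst m mE a%:E) EFinM -probE// muleC.
rewrite ler_norml; apply/andP; split.
  have iD : (\int[m]_(q in E) ((f q)%:E + e%:E) =
      \int[m]_(q in E) (f q)%:E + \int[m]_(q in E) e%:E)%E.
    by apply: ge0_integralD => // q _; rewrite lee_fin.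
  rewrite lerBrDr addrC lerBlDr -lee_fin EFinD vE -!icst -iD.
  apply: ge0_le_integral => //.
  - by apply: emeasurable_funD.
  - move=> q Eq; rewrite -EFinD lee_fin.
    by have := fx q Eq; rewrite ler_norml => /andP[]; lra.
rewrite lerBlDr addrC -mulrDr -lee_fin vE -icst; apply: ge0_le_integral => //.
- by move=> q _; rewrite lee_fin.
- by move=> q Eq; rewrite lee_fin; have := fx q Eq; rewrite ler_norml => /andP[]; lra.
Qed.

End average.

Section family.
Context {R : realType} {Q : ptopologicalType} (m : probability (borel Q) R).

(* The law of [(x, q)] under [P] disintegrates as [m] followed by [k]. *)
Definition family_law (X : ptopologicalType) (k : Q -> probability (borel X) R)
    d (Om : measurableType d) (P : probability Om R) (x : Om -> X) (q : Om -> Q) : Prop :=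
  [/\ measurable_fun setT (x : Om -> borel X), measurable_fun setT (q : Om -> borel Q)
    & forall (A : set (borel X)) (E : set (borel Q)), measurable A -> measurable E ->
      ((prob P (x @^-1` A `&` q @^-1` E))%:E = \int[m]_(z in E) (prob (k z) A)%:E)%E].

Definition measurable_family (X : ptopologicalType) (k : Q -> probability (borel X) R) : Prop :=
  forall A : set (borel X), measurable A ->
    measurable_fun setT ((fun z => prob (k z) A) : borel Q -> R).

Lemma family_law_snd (X : ptopologicalType) (k : Q -> probability (borel X) R)
    d (Om : measurableType d) (P : probability Om R) (x : Om -> X) (q : Om -> Q)
    (E : set (borel Q)) :
  family_law k P x q -> measurable E -> prob P (q @^-1` E) = prob m E.
Proof.
move=> [_ _ h] mE; apply: EFin_inj; have := h setT E measurableT mE.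
rewrite preimage_setT setTI => ->; under eq_integral do rewrite prob_setT.
by rewrite integral_cst// mul1e; exact: probE.
Qed.

End family.

(** * Discretization of the base *)

Section dopt_perturb.
Context {R : realType} {I J : finType} (C : I -> J -> R) (K mass del e : R).
Hypotheses (K0 : 0 <= K) (CK : forall i j, 0 <= C i j <= K).
Hypotheses (mass0 : 0 <= mass) (e0 : 0 < e).
Hypothesis small : K * (\sum_(i : I) del + \sum_(j : J) del) <= e.
Variables (a : I -> R) (b : J -> R) (A : I -> R) (B : J -> R).
Hypothesis ab : exists p, dcoupling a b p.
Hypotheses (aA : forall i, `|A i - mass * a i| <= mass * del)
  (bB : forall j, `|B j - mass * b j| <= mass * del).

Let C0 i j : 0 <= C i j. Proof. by case/andP: (CK i j). Qed.

Let close : K * (\sum_i `|A i - mass * a i| + \sum_j `|B j - mass * b j|) <= mass * e.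
Proof.
apply: (@le_trans _ _ (K * (mass * (\sum_(i : I) del + \sum_(j : J) del)))).
  by rewrite ler_wpM2l// mulrDr !mulr_sumr lerD// ler_sum.
by rewrite mulrCA ler_wpM2l.
Qed.

(** Move the marginals of [g] to [mass * a] and [mass * b], then divide by [mass]. A null cell is
    treated apart; there only the sign of the cost matters. *)
Lemma dopt_perturb_lower g : dcoupling A B g ->
  mass * dopt C a b <= dcost C g + mass * e.
Proof.
move=> gAB; have [p pab] := ab; have [a0 b0] := dcoupling_ge0 pab.
have [massE|mass_neq0] := eqVneq mass 0.
  rewrite massE !mul0r addr0; apply: dcost_ge0 => //.
  by case: gAB.
have mass_gt0 : 0 < mass by rewrite lt_neqAle eq_sym mass_neq0.
have [p' p'ab p'g] := dcoupling_perturb (a' := fun i => mass * a i)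
  (b' := fun j => mass * b j) K0 CK gAB (fun i => mulr_ge0 mass0 (a0 i))
  (fun j => mulr_ge0 mass0 (b0 j)) (dcoupling_sum (dcouplingZ mass0 pab)).
apply: le_trans (lerD (lexx _) close); apply: le_trans p'g.
rewrite -ler_pdivlMl// -dcostZ; apply: dopt_le => //.
have iv0 : 0 <= mass^-1 by rewrite invr_ge0.
have := dcouplingZ iv0 p'ab.
rewrite (_ : (fun i => mass^-1 * (mass * a i)) = a).
  rewrite (_ : (fun j => mass^-1 * (mass * b j)) = b)//.
  by apply/funext => j; rewrite mulKf.
by apply/funext => i; rewrite mulKf.
Qed.

(** One [e] pays for a near-optimal matrix between [a] and [b], the other for moving its rescaled
    marginals to [A] and [B]. *)
Lemma dopt_perturb_upper : (forall i, 0 <= A i) -> (forall j, 0 <= B j) ->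
  \sum_i A i = \sum_j B j ->
  exists2 p, dcoupling A B p & dcost C p <= mass * (dopt C a b + 2 * e).
Proof.
move=> A0 B0 AB; have [q qab qe] := dopt_adherent C0 ab e0.
have [p pAB pq] := dcoupling_perturb K0 CK (dcouplingZ mass0 qab) A0 B0 AB.
exists p => //; apply: (le_trans pq); rewrite dcostZ.
have := close; under eq_bigr do rewrite distrC.
under [X in _ + X]eq_bigr do rewrite distrC.
move=> h; apply: (@le_trans _ _ (mass * (dopt C a b + e) + mass * e)).
  by apply: lerD h; rewrite ler_wpM2l// ltW.
by rewrite -mulrDr ler_wpM2l//; lra.
Qed.

End dopt_perturb.

(** The bound [del < 1] lets the same grid separate the values 0 and 1 of an indicator. The summand
    1 in [s] keeps it positive when [K = 0]. *)
Lemma small_grid (R : realType) (I J : finType) (K e : R) : 0 <= K -> 0 < e ->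
  exists del : R, [/\ 0 < del, del < 1 & K * (\sum_(i : I) del + \sum_(j : J) del) <= e].
Proof.
move=> K0 e0; set n := (#|I| + #|J|)%N.
have nE del : K * (\sum_(i : I) del + \sum_(j : J) del) = K * n%:R * del.
  by rewrite !sumr_const -mulrnDr -(mulr_natr del) mulrA mulrAC.
pose s : R := K * n%:R + 1.
have s0 : 0 < s by rewrite ltr_pwDr// mulr_ge0.
exists (Num.min 2^-1 (e / s)); rewrite nE; split.
- by rewrite lt_min invr_gt0 ltr0n divr_gt0.
- by rewrite gt_min invf_lt1 ?ltr1n.
- apply: (@le_trans _ _ (s * (e / s))); last by rewrite mulrC divfK// gt_eqF.
  apply: ler_pM; rewrite ?mulr_ge0 ?ge_min ?lexx ?orbT//.
    by rewrite le_min invr_ge0 ler0n divr_ge0// ltW.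
  by rewrite lerDl.
Qed.

Section cells.
Context {R : realType} {Q X Y : ptopologicalType} (m : probability (borel Q) R).
Context (c : X -> Y -> R) (U : nat -> set X) (V : nat -> set Y) (r : nat -> R).
Hypothesis cUV : rect_approx c U V r.
Variable W : nat -> set Q.
Hypothesis oW : forall i, open (W i).
Variables (k : Q -> probability (borel X) R) (l : Q -> probability (borel Y) R).
Hypotheses (mk : measurable_family k) (ml : measurable_family l).
Variables (n N : nat) (e : R).
Hypothesis e0 : 0 < e.

Let I := {ffun 'I_n -> bool}.
Let C := @cutoff _ r n.
Let K := cutoff_bound r n.
Let a q := @mark_law R _ U (k q) n.
Let b q := @mark_law R _ V (l q) n.

Let mU (i : I) : measurable (mark U n @^-1` [set i] : set (borel X)).
Proof. by apply: measurable_mark => j; apply: borel_open; case: cUV. Qed.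

Let mV (i : I) : measurable (mark V n @^-1` [set i] : set (borel Y)).
Proof. by apply: measurable_mark => j; apply: borel_open; case: cUV. Qed.

Let K0 : 0 <= K. Proof. exact: bigmax_ge_id. Qed.

Let CK i j : 0 <= C i j <= K. Proof. exact: cutoff_bounded. Qed.

Let C0 i j : 0 <= C i j. Proof. exact: cutoff_ge0. Qed.

Let ab q : exists p, dcoupling (a q) (b q) p.
Proof. exact: mark_law_dcoupling cUV _ _ _. Qed.

Let D q := discrete_wasserstein U V r (k q) (l q) n.

(** The grid is applied to the fiberwise laws of the marks together with the indicators of the first
    [N] sets [W i]. As [del < 1], these indicators are constant on cells, so points of one cell are
    not separated by any of these sets. *)
Lemma fiber_cells : exists (del : R) (L : finType) (rho : Q -> L),
  [/\ 0 <= del, K * (\sum_(i : I) del + \sum_(i : I) del) <= e,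
    forall z, measurable (rho @^-1` [set z] : set (borel Q)) &
    forall p q, rho p = rho q -> [/\ forall i, `|a p i - a q i| <= del,
      forall i, `|b p i - b q i| <= del &
      forall i, (i < N)%N -> W i p -> W i q]].
Proof.
have [del [del0 del1 delK]] := small_grid I I K0 e0.
pose f (x : I + I + 'I_N) (q : borel Q) : R :=
  match x with inl (inl i) => a q i | inl (inr i) => b q i | inr i => \1_(W i) q end.
have [||L [rho [mrho rhoE]]] := @grid_label R _ (borel Q) _ f del del0.
- move=> [[i|i]|i]; [exact: mk|exact: ml|].
  by apply: measurable_indic; exact: borel_open.
- move=> [[i|i]|i] q; rewrite /f.
  + by rewrite prob_ge0 prob_le1.
  + by rewrite prob_ge0 prob_le1.
  + by rewrite indicE; case: (_ \in _); rewrite ?lexx ?ler01.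
exists del, L, rho; split => //; first exact: ltW.
move=> p q pq; split => [i|i|i iN Wp].
- exact: (rhoE _ _ pq (inl (inl i))).
- exact: (rhoE _ _ pq (inl (inr i))).
have := rhoE _ _ pq (inr (Ordinal iN)); rewrite /f/= !indicE mem_set//=.
have [//|nWq] := pselect (W i q); rewrite memNset//= subr0 normr1.
by rewrite leNgt del1.
Qed.

Section rho.
Variables (del : R) (L : finType) (rho : Q -> L).
Hypotheses (del0 : 0 <= del) (small : K * (\sum_(i : I) del + \sum_(i : I) del) <= e)
  (mrho : forall z, measurable (rho @^-1` [set z] : set (borel Q)))
  (rhoE : forall p q, rho p = rho q -> [/\ forall i, `|a p i - a q i| <= del,
      forall i, `|b p i - b q i| <= del &
      forall i, (i < N)%N -> W i p -> W i q]).

(** The default serves labels that are not attained, whose cells are empty. *)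
Let rep z := if pselect (exists q, rho q = z) is left h then sval (cid h) else point.

Let rho_rep q : rho (rep (rho q)) = rho q.
Proof.
rewrite /rep; case: pselect => [h|]; last by case; exists q.
by case: cid => /= p.
Qed.

Definition cell_cost (q : Q) : R := D (rep (rho q)).

Let E z := rho @^-1` [set z] : set (borel Q).
Let mass z := prob m (E z).

Let D_ge0 q : 0 <= D q.
Proof. exact: (dopt_ge0 C0 (ab q)). Qed.

Lemma cell_cost_ge0 q : 0 <= cell_cost q. Proof. exact: D_ge0. Qed.

Lemma measurable_cell_cost : measurable_fun setT ((fun q => (cell_cost q)%:E) : borel Q -> \bar R).
Proof. exact: (@measurable_label_fun R _ (borel Q) _ rho (fun z => D (rep z))). Qed.

Lemma integral_cell_cost :
  (\int[m]_q (cell_cost q)%:E = (\sum_z D (rep z) * mass z)%:E)%E.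
Proof. exact: (@integral_label R _ (borel Q) m _ rho (fun z => D (rep z))). Qed.

(** The perturbation bound with [mass = 1], used in both directions between two fibers of one
    cell. *)
Lemma cell_cost_close q : `|cell_cost q - D q| <= e.
Proof.
have half p p' : rho p = rho p' -> D p <= D p' + e.
  move=> pp'; have [ha hb _] := rhoE pp'; have [g gab] := ab p'.
  apply/ler_addgt0Pr => h h0; have [g' g'ab g'e] := dopt_adherent C0 (ab p') h0.
  have := @dopt_perturb_lower _ _ _ C K 1 del e K0 CK ler01 small (a p) (b p)
    (a p') (b p') (ab p) _ _ g' g'ab.
  rewrite !mul1r => hh; apply: (@le_trans _ _ (dcost C g' + e)).
    by apply: hh => i; rewrite !mul1r distrC.
  by rewrite addrAC lerD2r ltW.
by rewrite /cell_cost ler_norml lerBrDr addrC lerBlDr lerBlDl !half ?rho_rep.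
Qed.

Section law.
Context d {Om : measurableType d} (P : probability Om R).

(** The mass of a mark together with a cell is the integral over the cell of the fiberwise masses of
    that mark, all within [del] of the one at the representative. *)
Lemma mass_close (Z : ptopologicalType) (A : nat -> set Z) (j : Q -> probability (borel Z) R)
    (x : Om -> Z) (u : Om -> Q) i z :
  (forall i, open (A i)) -> measurable_family j ->
  (forall p q, rho p = rho q -> forall i,
     `|@mark_law R _ A (j p) n i - @mark_law R _ A (j q) n i| <= del) ->
  family_law m j P x u ->
  `|prob P ((mark A n \o x) @^-1` [set i] `&` u @^-1` E z) -
    mass z * @mark_law R _ A (j (rep z)) n i| <= mass z * del.
Proof.
move=> oA mj hj [mx mu h].
have mi : measurable (mark A n @^-1` [set i] : set (borel Z)).
  by apply: measurable_mark => p; exact: borel_open.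
apply: (@average_close R _ (borel Q) m (fun q => prob (j q) (mark A n @^-1` [set i]))).
- exact: mrho.
- exact: mj.
- by move=> q; exact: prob_ge0.
- exact: prob_ge0.
- exact: del0.
- move=> q Eq; have <- : rho q = z by exact: Eq.
  by apply: hj; rewrite rho_rep.
- exact: (h _ _ mi (mrho z)).
Qed.

(** Restricted to a cell, the joint law of the two marks is a matrix whose marginals are close to
    [mass z] times those of the representative. The errors [mass z * e] add up to [e]. *)
Lemma cell_cost_lower (x : Om -> X) (u : Om -> Q) (y : Om -> Y) :
  family_law m k P x u -> family_law m l P y u ->
  (\int[m]_q (cell_cost q)%:E <=
   \int[P]_w (cutoff r (mark U n (x w)) (mark V n (y w)))%:E + e%:E)%E.
Proof.
move=> lx ly; have [mx mu _] := lx; have [my _ _] := ly.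
rewrite integral_cell_cost (integral_cutoff cUV mx my) -EFinD lee_fin.
pose Al i := (mark U n \o x) @^-1` [set i]; pose Be j := (mark V n \o y) @^-1` [set j].
pose G z := u @^-1` E z.
have mAl i : measurable (Al i) by exact: (measurable_markX cUV mx).
have mBe i : measurable (Be i) by exact: (measurable_markY cUV my).
have mG z : measurable (G z).
  by rewrite -[X in measurable X]setTI; exact: (mu measurableT _ (mrho z)).
pose g z i j := prob P (Al i `&` Be j `&` G z).
have gz z : D (rep z) * mass z <= dcost C (g z) + mass z * e.
  rewrite mulrC; apply: (@dopt_perturb_lower _ _ _ C K (mass z) del e K0 CK
    (prob_ge0 _ _) small (a (rep z)) (b (rep z)) (fun i => prob P (Al i `&` G z))
    (fun j => prob P (Be j `&` G z))).
  - exact: ab.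
  - move=> i; apply: mass_close => //; first by case: cUV.
    by move=> p q /rhoE[].
  - move=> i; apply: mass_close => //; first by case: cUV.
    by move=> p q /rhoE[].
  - split => [i j|i|j]; first exact: prob_ge0.
    + under eq_bigr do rewrite /g setIAC.
      by rewrite -prob_partition//; exact: measurableI.
    + under eq_bigr do rewrite /g -setIA setIC.
      by rewrite -prob_partition//; exact: measurableI.
have gE : \sum_z dcost C (g z) = dcost C (fun i j => prob P (Al i `&` Be j)).
  rewrite /dcost exchange_big; apply: eq_bigr => i _.
  rewrite exchange_big; apply: eq_bigr => j _.
  rewrite -mulr_sumr (@prob_partition _ _ _ P _ (rho \o u) (Al i `&` Be j))//.
  exact: measurableI.
apply: (@le_trans _ _ (\sum_z (dcost C (g z) + mass z * e))); first exact: ler_sum.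
rewrite big_split/= gE lerD2l -mulr_suml (_ : \sum_z mass z = 1) ?mul1r//.
rewrite -(prob_setT m) (prob_partition m mrho measurableT).
by apply: eq_bigr => z _; rewrite setTI.
Qed.

End law.

Section upper.
Context d d' {S : measurableType d} {T : measurableType d'}.
Variables (M : probability S R) (M' : probability T R).
Variables (x : S -> X) (u : S -> Q) (y : T -> Y) (v : T -> Q).
Hypotheses (lx : family_law m k M x u) (ly : family_law m l M' y v).

(** Labels are pairs of a mark and a cell, and the matrix [pp] vanishes between distinct cells. The
    coupling therefore charges only pairs whose base points lie in one cell, where the first [N]
    sets [W i] cannot separate them. *)
Lemma cell_cost_upper : exists gam : probability (S * T)%type R,
  [/\ coupled M M' gam,
     (\int[gam]_w (cutoff r (mark U n (x w.1)) (mark V n (y w.2)))%:E <=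
       \int[m]_q (cell_cost q)%:E + (2 * e)%:E)%E
   & forall i, (i < N)%N -> prob gam (u @^-1` W i `*` v @^-1` (~` W i)) = 0].
Proof.
have [mx mu _] := lx; have [my mv _] := ly.
pose Al i := (mark U n \o x) @^-1` [set i]; pose Be j := (mark V n \o y) @^-1` [set j].
pose G z := u @^-1` E z; pose H z := v @^-1` E z.
have mAl i : measurable (Al i) by exact: (measurable_markX cUV mx).
have mBe i : measurable (Be i) by exact: (measurable_markY cUV my).
have mG z : measurable (G z).
  by rewrite -[X in measurable X]setTI; exact: (mu measurableT _ (mrho z)).
have mH z : measurable (H z).
  by rewrite -[X in measurable X]setTI; exact: (mv measurableT _ (mrho z)).
have /choice[p hp] : forall z, exists p, dcoupling (fun i => prob M (Al i `&` G z))
    (fun j => prob M' (Be j `&` H z)) p /\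
    dcost C p <= mass z * (D (rep z) + 2 * e).
  move=> z; have [||||||p p1 p2] := @dopt_perturb_upper _ _ _ C K (mass z) del e K0 CK
    (prob_ge0 _ _) e0 small (a (rep z)) (b (rep z)) (fun i => prob M (Al i `&` G z))
    (fun j => prob M' (Be j `&` H z)); last by exists p.
  - exact: ab.
  - move=> i; apply: mass_close => //; first by case: cUV.
    by move=> ? ? /rhoE[].
  - move=> i; apply: mass_close => //; first by case: cUV.
    by move=> ? ? /rhoE[].
  - by move=> i; exact: prob_ge0.
  - by move=> i; exact: prob_ge0.
  - transitivity (mass z).
      under eq_bigr do rewrite setIC.
      by rewrite -prob_partition//; exact: (family_law_snd lx (mrho z)).
    under [RHS]eq_bigr do rewrite setIC.
    by rewrite -prob_partition//; exact/esym/(family_law_snd ly (mrho z)).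
pose al s := (mark U n (x s), rho (u s)); pose be t := (mark V n (y t), rho (v t)).
have alE i z : al @^-1` [set (i, z)] = Al i `&` G z.
  by apply/seteqP; split => s /=; [move=> [<- <-]|case; rewrite /Al /G /E /al /= => -> ->].
have beE i z : be @^-1` [set (i, z)] = Be i `&` H z.
  by apply/seteqP; split => s /=; [move=> [<- <-]|case; rewrite /Be /H /E /be /= => -> ->].
have mal i : measurable (al @^-1` [set i]).
  by case: i => i z; rewrite alE; exact: measurableI.
have mbe i : measurable (be @^-1` [set i]).
  by case: i => i z; rewrite beE; exact: measurableI.
pose pp (iz jz : I * L) := if iz.2 == jz.2 then p iz.2 iz.1 jz.1 else 0.
have ppC : dcoupling (fun i => prob M (al @^-1` [set i])) (fun j => prob M' (be @^-1` [set j])) pp.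
  split.
  - by move=> [i z] [j z']; rewrite /pp; case: ifP => //= _; case: (hp z) => -[].
  - move=> [i z]; rewrite -(pair_big xpredT xpredT (fun j z' => pp (i, z) (j, z')))/= alE.
    have [[_ <- _] _] := hp z; apply: eq_bigr => j _; rewrite /pp -big_mkcond/=.
    by rewrite (big_pred1 z)// => z'; rewrite /= eq_sym.
  - move=> [j z]; rewrite -(pair_big xpredT xpredT (fun i z' => pp (i, z') (j, z)))/= beE.
    have [[_ _ <-] _] := hp z; apply: eq_bigr => i _; rewrite /pp -big_mkcond/=.
    by rewrite (big_pred1 z).
have [gam gMM gp] := block_coupling mal mbe ppC.
have mfal i : measurable ((al \o fst) @^-1` [set i] : set (S * T)).
  by rewrite comp_preimage -[X in measurable X]setTI; exact: measurable_fst.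
have mfbe i : measurable ((be \o snd) @^-1` [set i] : set (S * T)).
  by rewrite comp_preimage -[X in measurable X]setTI; exact: measurable_snd.
exists gam; split => //.
  rewrite integral_cell_cost -EFinD.
  have := @integral_label2 _ _ _ gam _ _ (al \o fst) (be \o snd)
    (fun iz jz => C iz.1 jz.1) mfal mfbe (fun iz jz => C0 iz.1 jz.1).
  move=> ->; rewrite lee_fin.
  rewrite (_ : (fun i j => prob gam _) = pp); last first.
    by apply/funext => i; apply/funext => j; rewrite -gp.
  rewrite (_ : dcost _ _ = \sum_z dcost C (p z)).
    apply: (@le_trans _ _ (\sum_z mass z * (D (rep z) + 2 * e))).
      by apply: ler_sum => z _; case: (hp z).
    under eq_bigr do rewrite mulrDr mulrC.
    rewrite big_split/= lerD2l -mulr_suml (_ : \sum_z mass z = 1) ?mul1r//.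
    rewrite -(prob_setT m) (prob_partition m mrho measurableT).
    by apply: eq_bigr => z _; rewrite setTI.
  rewrite /dcost -(pair_big xpredT xpredT (fun i z =>
    \sum_jz C i jz.1 * pp (i, z) jz))/= exchange_big/=.
  apply: eq_bigr => z _; apply: eq_bigr => i _.
  rewrite -(pair_big xpredT xpredT (fun j z' => C i j * pp (i, z) (j, z')))/=.
  apply: eq_bigr => j _; rewrite -mulr_sumr /pp -big_mkcond/=.
  by rewrite (big_pred1 z)// => z'; rewrite /= eq_sym.
move=> i iN; have mWX : measurable (u @^-1` W i `*` v @^-1` (~` W i)).
  apply: measurableX.
    by rewrite -[X in measurable X]setTI; apply: mu => //; exact: borel_open.
  rewrite -[X in measurable X]setTI; apply: mv => //.
  by apply: measurableC; exact: borel_open.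
rewrite (prob_partition gam mfal mWX) big1// => iz _.
rewrite (prob_partition gam mfbe) ?big1//; last exact: measurableI.
move=> jz _; have [zz|zz] := eqVneq iz.2 jz.2.
  rewrite (_ : _ `&` _ = set0) ?prob_set0//; apply/seteqP; split => // -[s t] /=.
  move=> [[[Wu nWv] als] bet]; apply: nWv.
  have /rhoE[_ _ h] : rho (u s) = rho (v t).
    have /= := congr1 snd als; have /= := congr1 snd bet.
    by move=> -> ->.
  exact: h.
apply/eqP; rewrite eq_le prob_ge0 andbT.
have <- : pp iz jz = 0 by rewrite /pp (negbTE zz).
rewrite -gp; apply: le_prob => //.
- by apply: measurableI => //; exact: measurableI.
- exact: measurableX.
- by move=> [s t] [[_ ?] ?].
Qed.

End upper.

End rho.

End cells.

(** * Fibered transport *)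

(** Hides the cells behind one function [w], chosen before the probability spaces. The same [w]
    serves the lower bound, for any space carrying [x] and [y] over a common base point, and the
    upper bound, for any two spaces to be coupled. *)
Lemma fibered_discretization (R : realType) (Q X Y : ptopologicalType) (m : probability (borel Q) R)
    (c : X -> Y -> R) (U : nat -> set X) (V : nat -> set Y) (r : nat -> R) (W : nat -> set Q)
    (k : Q -> probability (borel X) R) (l : Q -> probability (borel Y) R) (n N : nat) (e : R) :
  rect_approx c U V r -> (forall i, open (W i)) ->
  measurable_family k -> measurable_family l -> 0 < e ->
  exists w : Q -> R,
  [/\ measurable_fun setT ((fun q => (w q)%:E) : borel Q -> \bar R),
      forall q, 0 <= w q,
      forall q, `|w q - discrete_wasserstein U V r (k q) (l q) n| <= e,
      forall d (Om : measurableType d) (P : probability Om R) (x : Om -> X) (u : Om -> Q)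
        (y : Om -> Y), family_law m k P x u -> family_law m l P y u ->
        (\int[m]_q (w q)%:E <=
         \int[P]_z (cutoff r (mark U n (x z)) (mark V n (y z)))%:E + e%:E)%E
    & forall d d' (S : measurableType d) (T : measurableType d') (M : probability S R)
        (M' : probability T R) (x : S -> X) (u : S -> Q) (y : T -> Y) (v : T -> Q),
        family_law m k M x u -> family_law m l M' y v ->
        exists gam : probability (S * T)%type R,
        [/\ coupled M M' gam,
           (\int[gam]_z (cutoff r (mark U n (x z.1)) (mark V n (y z.2)))%:E <=
             \int[m]_q (w q)%:E + (2 * e)%:E)%E
         & forall i, (i < N)%N -> prob gam (u @^-1` W i `*` v @^-1` (~` W i)) = 0]].
Proof.
move=> cUV oW mk ml e0.
have [del [L [rho [del0 small mrho rhoE]]]] := fiber_cells cUV oW mk ml n N e0.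
exists (cell_cost U V r k l n rho); split.
- exact: (measurable_cell_cost U V r k l n mrho).
- exact: (cell_cost_ge0 cUV).
- exact: (cell_cost_close cUV small rhoE).
- move=> d Om P x u y lx ly; exact: (cell_cost_lower cUV mk ml del0 small mrho rhoE lx ly).
- move=> d d' S T M M' x u y v lx ly.
  exact: (cell_cost_upper cUV oW mk ml e0 del0 small mrho rhoE lx ly).
Qed.

Section fibered_transport.
Context {R : realType} {Q X Y : ptopologicalType} (m : probability (borel Q) R).
Context (c : X -> Y -> R) (U : nat -> set X) (V : nat -> set Y) (r : nat -> R).
Hypothesis cUV : rect_approx c U V r.
Hypothesis c0 : forall x y, 0 <= c x y.
Hypotheses (pX : polish_space R X) (pY : polish_space R Y).
Variable W : nat -> set Q.
Hypothesis oW : forall i, open (W i).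
Variables (k : Q -> probability (borel X) R) (l : Q -> probability (borel Y) R).
Hypotheses (mk : measurable_family k) (ml : measurable_family l).

Let Wc q := wasserstein c (k q) (l q).

Let e n : R := n.+1%:R^-1.

Let e_gt0 n : 0 < e n. Proof. by rewrite invr_gt0. Qed.

Let approx_cvg (w : nat -> Q -> R) q :
  (forall n, `|w n q - discrete_wasserstein U V r (k q) (l q) n| <= e n) ->
  (w n q)%:E @[n --> \oo] --> Wc q.
Proof.
move=> hw; have hD : (discrete_wasserstein U V r (k q) (l q) n)%:E @[n --> \oo] --> Wc q.
  exact: (cvg_discrete_wasserstein cUV c0 pX pY).
set D := discrete_wasserstein U V r (k q) (l q) in hw hD.
have h0 : w n q - D n @[n --> \oo] --> (0 : R).
  apply/cvgrPdist_le => eps eps0; near=> n; rewrite sub0r normrN.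
  apply: (le_trans (hw n)); near: n.
  exact: (cvgr_le _ (@cvg_harmonic R)).
rewrite (_ : (fun n => _) = (fun n => (D n)%:E + (w n q - D n)%:E)%E).
  rewrite -[Wc q]adde0; apply: cvgeD => //; first by rewrite fin_num_adde_defl.
  by apply: cvg_EFin => //; exact: nearW.
by apply/funext => n; rewrite -EFinD addrC subrK.
Unshelve. all: by end_near. Qed.

Lemma measurable_wasserstein : measurable_fun setT (Wc : borel Q -> \bar R).
Proof.
(* Only values of the cost matter here, so no set [W i] has to be respected: [N] is 0. *)
have /choice[w hw] := fun n => fibered_discretization m n 0 cUV oW mk ml (e_gt0 n).
apply: (@emeasurable_fun_cvg _ (borel Q) R setT (fun n q => (w n q)%:E) Wc) => [n|q _].
  by case: (hw n).
by apply: approx_cvg => n; case: (hw n).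
Qed.

Lemma wasserstein_ge0 q : (0 <= Wc q)%E.
Proof.
apply: le_ereal_inf_tmp => _ [pi _ <-].
by apply: integral_ge0 => z _; rewrite lee_fin.
Qed.

(** The functions [w n] converge pointwise to the fiberwise cost but need not be monotone in [n];
    hence Fatou's lemma. *)
Lemma integral_wasserstein_le d (Om : measurableType d) (P : probability Om R)
    (x : Om -> X) (u : Om -> Q) (y : Om -> Y) :
  family_law m k P x u -> family_law m l P y u ->
  (\int[m]_q Wc q <= \int[P]_z (c (x z) (y z))%:E)%E.
Proof.
move=> lx ly; have [mx mu _] := lx; have [my _ _] := ly.
have /choice[w hw] := fun n => fibered_discretization m n 0 cUV oW mk ml (e_gt0 n).
pose f n (q : borel Q) := (w n q)%:E.
have wq q : limn_einf (f ^~ q) = Wc q.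
  rewrite (cvg_limn_einf_sup (l := Wc q))//.
  by apply: approx_cvg => n; case: (hw n).
have fw : (\int[m]_q Wc q <= limn_einf (fun n => \int[m]_q f n q))%E.
  under eq_integral do rewrite -wq.
  apply: fatou => // [n|n q _]; first by case: (hw n).
  by rewrite lee_fin; case: (hw n).
apply: (le_trans fw); set L := (\int[P]_z _)%E.
have [Loo|Lfin] := eqVneq L +oo%E; first by rewrite Loo leey.
have L0 : (0 <= L)%E by apply: integral_ge0 => z _; rewrite lee_fin.
have LE : L = (fine L)%:E by rewrite fineK// ge0_fin_numE// lt_neqAle Lfin leey.
have hn n : (\int[m]_q f n q <= (fine L + e n)%:E)%E.
  rewrite EFinD -LE; case: (hw n) => _ _ _ h _; apply: (le_trans (h _ _ _ _ _ _ lx ly)).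
  by rewrite leeD2r//; exact: (le_integral_cutoff cUV c0 mx my).
have hc : (fine L + e n)%:E @[n --> \oo] --> L.
  rewrite LE; apply: cvg_EFin; first exact: nearW.
  rewrite -[X in _ --> X]addr0; apply: cvgD; first exact: cvg_cst.
  exact: cvg_harmonic.
rewrite limn_einf_lim.
apply: (@le_trans _ _ (limn (fun n => (fine L + e n)%:E))); last by rewrite (cvg_lim _ hc).
apply: lee_lim; [exact: is_cvg_einfs|by apply/cvg_ex; exists L|].
apply: nearW => n; apply: le_trans (hn n).
by apply: ereal_inf_lbound; exists n => /=.
Qed.

(** Stage [n] works at cutoff level [n] and respects the first [n] sets [W i]. The rectangle of a
    given [i] is null from stage [i + 1] on, hence null in the limit. *)
Lemma integral_wasserstein_coupling d (S : measurableType d) (T : ptopologicalType)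
    (M : probability S R) (M' : probability (borel T) R)
    (x : S -> X) (u : S -> Q) (y : T -> Y) (v : T -> Q) :
  polish_space R T -> family_law m k M x u -> family_law m l M' y v ->
  exists gam : probability (S * borel T)%type R,
  [/\ coupled M M' gam,
      (\int[gam]_z (c (x z.1) (y z.2))%:E <= \int[m]_q Wc q)%E
    & forall i, prob gam (u @^-1` W i `*` v @^-1` (~` W i)) = 0].
Proof.
move=> pT lx ly; have [mx mu _] := lx; have [my mv _] := ly.
have /choice[w hw] := fun n => fibered_discretization m n n cUV oW mk ml (e_gt0 n).
have /choice[gam hg] : forall n, exists gam : probability (S * borel T)%type R,
    [/\ coupled M M' gam,
      (\int[gam]_z (cutoff r (mark U n (x z.1)) (mark V n (y z.2)))%:E <=
        \int[m]_q (w n q)%:E + (2 * e n)%:E)%E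
    & forall i, (i < n)%N -> prob gam (u @^-1` W i `*` v @^-1` (~` W i)) = 0].
  by move=> n; case: (hw n) => _ _ _ _ h; exact: h.
have [|g gMM [G [PG Goo hG]]] := coupling_limit (M := M) (N := M') (gam := gam) pT.
  by move=> n; case: (hg n).
exists g; split => //.
  apply: (@limit_cost _ _ _ _ _ _ _ cUV c0 _ _ S (borel T) x y mx my gam g G _
    (fun n => 3 * e n) PG Goo hG).
  - rewrite -[X in _ --> X](mulr0 3); apply: cvgM; first exact: cvg_cst.
    exact: cvg_harmonic.
  - by apply: integral_ge0 => q _; exact: wasserstein_ge0.
  - move=> n; case: (hg n) => _ h _; apply: (le_trans h).
    (* [2 * e n] comes from the coupling; the remaining [e n] from replacing [w n] by the finite
       optimum, itself at most the fiberwise Wasserstein cost. *)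
    rewrite (_ : 3 * e n = e n + 2 * e n); last by ring.
    rewrite EFinD addeA leeD2r//; case: (hw n) => mw w0 wD _ _.
    have ie : (\int[m]_q (e n)%:E = (e n)%:E)%E.
      transitivity ((e n)%:E * m setT)%E; first exact: integral_cst.
      by rewrite probability_setT mule1.
    have iD : (\int[m]_q (Wc q + (e n)%:E) = \int[m]_q Wc q + (e n)%:E)%E.
      rewrite -[X in (_ + X)%E]ie; apply: ge0_integralD => //.
      - by move=> q _; exact: wasserstein_ge0.
      - exact: measurable_wasserstein.
      - by move=> q _; rewrite lee_fin ltW.
    rewrite -iD.
    apply: ge0_le_integral => //.
    + by move=> q _; rewrite lee_fin.
    + by apply: emeasurable_funD => //; exact: measurable_wasserstein.
    + move=> q _; apply: (@le_trans _ _
        (discrete_wasserstein U V r (k q) (l q) n + e n)%:E).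
        by rewrite lee_fin -lerBlDl; have := wD q; rewrite ler_norml => /andP[].
      by rewrite EFinD leeD2r//; exact: (wasserstein_ge cUV).
move=> i; have mW : measurable (W i : set (borel Q)) by exact: borel_open.
have mu' : measurable (u @^-1` W i) by rewrite -[X in measurable X]setTI; exact: mu.
have mv' : measurable (v @^-1` (~` W i) : set (borel T)).
  by rewrite -[X in measurable X]setTI; apply: mv => //; exact: measurableC.
have h0 : prob (gam n) (u @^-1` W i `*` v @^-1` (~` W i)) @[n --> G] --> (0 : R).
  apply: cvg_near_cst; apply: Goo; near=> n; case: (hg n) => _ _; apply.
  by near: n; exists i.+1.
apply: (cvg_unique _ (hG _ _ mu' mv') h0); exact: norm_hausdorff.
Unshelve. all: by end_near. Qed.

End fibered_transport.

(** * Gluing and shifting *)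

Lemma prod_polish (R : realType) (X Y : topologicalType) :
  polish_space R X -> polish_space R Y -> polish_space R (X * Y)%type.
Proof.
move=> [[S cS dS] [d1 [[m1 s1 t1] h1 k1]]] [[S' cS' dS'] [d2 [[m2 s2 t2] h2 k2]]].
split.
  exists (S `*` S'); first exact: countableX.
  move=> G [[x y] Gxy] oG; have [[A B] [/= xA yB] AB] : nbhs (x, y) G.
    exact: open_nbhs_nbhs.
  have [x' [Ax' Sx']] := dS A° (ex_intro _ x xA) (@open_interior _ A).
  have [y' [By' Sy']] := dS' B° (ex_intro _ y yB) (@open_interior _ B).
  exists (x', y'); split => //; apply: AB; split => /=.
    exact: interior_subset Ax'.
  exact: interior_subset By'.
exists (fun z z' => Num.max (d1 z.1 z'.1) (d2 z.2 z'.2)).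
have d1_ge0 x y : 0 <= d1 x y by exact: (@metric_ge0 R X d1).
have d2_ge0 x y : 0 <= d2 x y by exact: (@metric_ge0 R Y d2).
split.
- split.
  + move=> [x y] [x' y'] /=; split.
      move=> d0; have : Num.max (d1 x x') (d2 y y') <= 0 by rewrite d0.
      rewrite ge_max => /andP[hx hy]; congr pair.
        by apply/m1/eqP; rewrite eq_le hx d1_ge0.
      by apply/m2/eqP; rewrite eq_le hy d2_ge0.
    by move=> [-> ->]; rewrite (proj2 (m1 _ _) erefl) (proj2 (m2 _ _) erefl) maxxx.
  + by move=> x y; rewrite s1 s2.
  + move=> x y z; rewrite ge_max; apply/andP; split.
      by apply: (le_trans (t1 _ y.1 _)); rewrite lerD// le_max lexx.
    by apply: (le_trans (t2 _ y.2 _)); rewrite lerD// le_max lexx orbT.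
- move=> [x y] A; split.
    move=> [[B B'] [/= /h1[e e0 eB] /h2[e' e'0 eB']] BA].
    exists (Num.min e e'); first by rewrite lt_min e0.
    move=> [x' y'] /=; rewrite gt_max !lt_min => /andP[/andP[xe _] /andP[_ ye]].
    by apply: BA; split => /=; [exact: eB|exact: eB'].
  move=> [e e0 eA]; exists ([set x' | d1 x x' < e], [set y' | d2 y y' < e]).
    by split; [apply/h1|apply/h2]; exists e.
  by move=> [x' y'] [/= xe ye]; apply: eA => /=; rewrite gt_max xe.
- move=> u cu.
  have [|x ux] := k1 (fst \o u).
    move=> e /cu[N hN]; exists N => m n mN nN.
    by have := hN m n mN nN; rewrite gt_max => /andP[].
  have [|y uy] := k2 (snd \o u).
    move=> e /cu[N hN]; exists N => m n mN nN.
    by have := hN m n mN nN; rewrite gt_max => /andP[].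
  exists (x, y); rewrite (_ : u = fun n => ((fst \o u) n, (snd \o u) n)).
    exact: cvg_pair.
  by apply/funext => n /=; case: (u n).
Qed.

Section diagonal.
Context {R : realType} {Q : ptopologicalType} (W : nat -> set Q).
Hypotheses (bW : base_seq W) (pQ : polish_space R Q).

(** Distinct points are separated by a set of the base, so [u <> v] forces one of countably many
    null events. *)
Lemma diagonal_ae d (Om : measurableType d) (P : probability Om R) (u v : Om -> Q) :
  measurable_fun setT (u : Om -> borel Q) -> measurable_fun setT (v : Om -> borel Q) ->
  (forall i, prob P (u @^-1` W i `&` v @^-1` (~` W i)) = 0) ->
  {ae P, forall z, u z = v z}.
Proof.
move=> mu mv h; have [oW hW] := bW.
have mB i : measurable (u @^-1` W i `&` v @^-1` (~` W i)).
  have mW : measurable (W i : set (borel Q)) by exact: borel_open.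
  apply: measurableI; first by rewrite -[X in measurable X]setTI; exact: mu.
  by rewrite -[X in measurable X]setTI; apply: mv => //; exact: measurableC.
apply: (negligibleS _ (negligible_bigcup (F := fun i => u @^-1` W i `&` v @^-1` (~` W i)) _)).
  move=> z /= uv; have [A uA nvA] := polish_separated pQ uv.
  by have [i Wu WA] := hW _ _ uA; exists i => //; split => // /WA.
move=> i; exists (u @^-1` W i `&` v @^-1` (~` W i)); split => //.
exact: etrans (probE P (mB i)) (congr1 EFin (h i)).
Qed.

End diagonal.

Section gluing.
Context {R : realType} {Q T : ptopologicalType} d {S : measurableType d}.
Hypotheses (pQ : polish_space R Q) (pT : polish_space R T).
Variables (M : probability S R) (N : probability (borel T) R) (u : S -> Q) (v : T -> Q).
Hypotheses (mu : measurable_fun setT (u : S -> borel Q))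
  (mv : measurable_fun setT (v : borel T -> borel Q)).
Hypothesis uv : forall E : set (borel Q), measurable E ->
  prob M (u @^-1` E) = prob N (v @^-1` E).

(* Fibered transport over [Q] for the cost 0, both fibers over [q] being
   reduced to the point [q]. *)
Lemma gluing (W : nat -> set Q) : (forall i, open (W i)) ->
  exists2 gam : probability (S * borel T)%type R, coupled M N gam &
    forall i, prob gam (u @^-1` W i `*` v @^-1` (~` W i)) = 0.
Proof.
move=> oW; have [m mE] := pushforward_probability M mu.
pose k (q : Q) : probability (borel Q) R := \d_(q : borel Q).
have mk : measurable_family k.
  by move=> A mA; exact: (measurable_indic mA).
have kint (A E : set (borel Q)) : measurable A -> measurable E ->
    (\int[m]_(z in E) (prob (k z) A)%:E = m (A `&` E))%E.
  by move=> mA mE'; rewrite -[RHS](integral_indic m mE' mA).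
have r0 : @rect_approx R Q Q (fun _ _ => 0) (fun _ => setT) (fun _ => setT) (fun _ => 0).
  split => //; [by move=> _; exact: openT|by move=> _; exact: openT|].
  by move=> x y a a0; exists 0%N.
have [|||gam [h1 _ h3]] := integral_wasserstein_coupling (m := m) r0 _ pQ pQ oW mk mk
  (M := M) (M' := N) (x := u) (u := u) (y := v) (v := v) pT.
- by [].
- split => // A E mA mE'; rewrite kint// -preimage_setI -probE ?mE//.
  by rewrite -[X in measurable X]setTI; apply: mu => //; exact: measurableI.
- split => // A E mA mE'; rewrite kint// -preimage_setI -uv; last exact: measurableI.
  rewrite -probE ?mE//.
  by rewrite -[X in measurable X]setTI; apply: mu => //; exact: measurableI.
- by exists gam.
Qed.

End gluing.

Section shift.
Context {R : realType}.

(** [f] need not be integrable. For [a < 0] the negative part of [g = f + a] is at most [- a], hence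
    of finite integral, and [f + g^- = g^+ - a] involves nonnegative functions only. *)
Lemma integral_shift d (T : measurableType d) (P : probability T R) (f : T -> \bar R) (a : R) :
  measurable_fun setT f -> (forall x, 0 <= f x)%E ->
  (\int[P]_x (f x + a%:E) = \int[P]_x f x + a%:E)%E.
Proof.
move=> mf f0.
have icst (b : R) : (\int[P]_x b%:E = b%:E)%E.
  transitivity (b%:E * P setT)%E; first exact: integral_cst.
  by rewrite probability_setT mule1.
have mc (b : R) : measurable_fun setT ((fun x => b%:E) : T -> \bar R) by exact: measurable_cst.
have [a0|a0] := leP 0 a.
  by rewrite -[in RHS](icst a) ge0_integralD// => x _; rewrite lee_fin.
pose g x := (f x + a%:E)%E.
have mg : measurable_fun setT g by exact: emeasurable_funD.
have na0 : 0 <= - a by rewrite oppr_ge0 ltW.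
have gE : (\int[P]_x f x + \int[P]_x g^\- x = \int[P]_x g^\+ x + (- a)%:E)%E.
  rewrite -[in RHS](icst (- a)) -!ge0_integralD//; last first.
  - exact: measurable_funeneg.
  - exact: measurable_funepos.
  apply: eq_integral => x _; rewrite /g funeposE funenegE.
  have := f0 x; case: (f x) => [y| |]//= y0.
    rewrite -!EFin_max -!EFinD; congr (_%:E); rewrite /Num.max.
    by case: ltP => h1; case: ltP => h2; lra.
  by rewrite maxye maxNye /= addye.
have gn_fin : (\int[P]_x g^\- x \is a fin_num)%E.
  rewrite ge0_fin_numE; last by apply: integral_ge0 => x _; exact: funeneg_ge0.
  apply: (@le_lt_trans _ _ (- a)%:E); last exact: ltry.
  rewrite -(icst (- a)); apply: ge0_le_integral => //.
  - exact: measurable_funeneg.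
  - move=> x _; rewrite funenegE /g ge_max lee_fin na0 andbT.
    have := f0 x; case: (f x) => [y| |]//= y0.
      by rewrite lee_fin opprD gerDr oppr_le0 -lee_fin.
    exact: leNye.
rewrite [LHS]integralE -/g.
move: gE gn_fin; case: (\int[P]_x g^\- x)%E => // y.
move=> /(congr1 (fun z => z + (a - y)%:E)%E) + _.
rewrite -[in RHS]addeA -EFinD addrA addNr sub0r => <-.
by rewrite -addeA -EFinD addrCA subrr addr0.
Qed.

Lemma ereal_inf_shift (A : set \bar R) (a : R) :
  ereal_inf [set (x + a%:E)%E | x in A] = (ereal_inf A + a%:E)%E.
Proof.
apply/eqP; rewrite eq_le; apply/andP; split.
  rewrite -leeBlDr//; apply: le_ereal_inf_tmp => x Ax; rewrite leeBlDr//.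
  by apply: ereal_inf_lbound; exists x.
apply: le_ereal_inf_tmp => _ [x Ax <-]; rewrite leeD2r//.
exact: ereal_inf_lbound.
Qed.

End shift.

(** * Flows *)

Lemma kernel_family (R : realType) (Q X : ptopologicalType) (k : R.-pker borel Q ~> borel X) :
  exists2 kp : Q -> probability (borel X) R, measurable_family kp &
    forall q, (kp q : set (borel X) -> \bar R) = k q.
Proof.
have /choice[kp kpE] := fun q => measure_probability (prob_kernel (s := k) q).
exists kp => // A mA; rewrite /prob; under eq_fun do rewrite kpE.
apply: measurableT_comp => //; exact: measurable_kernel.
Qed.

(** [m] may be any probability agreeing with the law of [p]; this lets two different measures be
    disintegrated over literally the same base measure. *)
Lemma conditional_family_law (R : realType) (Z Q X : ptopologicalType)
    (g : probability (borel Z) R) (p : Z -> Q) (q : Z -> X)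
    (k : R.-pker borel Q ~> borel X) (kp : Q -> probability (borel X) R)
    (m : probability (borel Q) R) :
  conditional_law g p q k -> (forall z, (kp z : set (borel X) -> \bar R) = k z) ->
  measurable_fun setT (p : borel Z -> borel Q) ->
  measurable_fun setT (q : borel Z -> borel X) ->
  (forall E : set (borel Q), measurable E -> g (p @^-1` E) = m E) ->
  family_law m kp g (q : borel Z -> X) (p : borel Z -> Q).
Proof.
move=> gk kpE mp mq gm; split => // A E mA mE.
have mA' : measurable (q @^-1` A : set (borel Z)).
  by rewrite -[X in measurable X]setTI; exact: mq.
have mE' : measurable (p @^-1` E : set (borel Z)).
  by rewrite -[X in measurable X]setTI; exact: mp.
rewrite -probE; last exact: measurableI.
rewrite setIC gk//; have [g' gE] := pushforward_probability g mp.
rewrite -gE; under [RHS]eq_integral do rewrite -probE// kpE.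
apply: eq_measure_integral => B mB _.
exact: etrans (congr1 (fun F => F B) gE) (gm B mB).
Qed.

Lemma family_law_comp (R : realType) (Q X : ptopologicalType) (m : probability (borel Q) R)
    (k : Q -> probability (borel X) R) d d' (Om : measurableType d) (Om' : measurableType d')
    (P : probability Om R) (P' : probability Om' R) (h : Om -> Om') (x : Om' -> X) (u : Om' -> Q) :
  measurable_fun setT h -> (forall A, measurable A -> prob P (h @^-1` A) = prob P' A) ->
  family_law m k P' x u -> family_law m k P (x \o h) (u \o h).
Proof.
move=> mh hP [mx mu H]; split; try exact: measurableT_comp.
move=> A E mA mE; rewrite -H// -hP//; apply: measurableI.
  by rewrite -[X in measurable X]setTI; exact: mx.
by rewrite -[X in measurable X]setTI; exact: mu.
Qed.

Lemma integral_same_law (R : realType) d d' (Om : measurableType d) (Om' : measurableType d')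
    (P : probability Om R) (P' : probability Om' R) (h : Om -> Om') (f : Om' -> \bar R) :
  measurable_fun setT h -> (forall A, measurable A -> prob P (h @^-1` A) = prob P' A) ->
  measurable_fun setT f -> (forall x, 0 <= f x)%E ->
  (\int[P]_x f (h x) = \int[P']_y f y)%E.
Proof.
move=> mh hP mf f0; have [g gE] := pushforward_probability P mh.
transitivity (\int[g]_y f y)%E.
  by rewrite gE (ge0_integral_pushforward mh).
apply: eq_measure_integral => A mA _.
apply: etrans (congr1 (fun F => F A) gE) _.
have mA' : measurable (h @^-1` A) by rewrite -[X in measurable X]setTI; exact: mh.
exact: etrans (probE P mA') (etrans (congr1 EFin (hP A mA)) (esym (probE P' mA))).
Qed.

Section cost.
Context {R : realType} {X Y : ptopologicalType}.
Hypotheses (pX : polish_space R X) (pY : polish_space R Y).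
Variable c : X -> Y -> R.
Hypothesis c0 : forall x y, 0 <= c x y.
Hypothesis lc : lower_semicontinuous (fun z : X * Y => (c z.1 z.2)%:E).

Lemma polish_rect_approx : exists U V r, rect_approx c U V r.
Proof.
have [B bB] := polish_base pX; have [B' bB'] := polish_base pY.
exact: (lsc_rect_approx bB bB').
Qed.

Lemma lsc_cost_measurable d (Om : measurableType d) (s : Om -> X) (t : Om -> Y) :
  measurable_fun setT (s : Om -> borel X) -> measurable_fun setT (t : Om -> borel Y) ->
  measurable_fun setT ((fun w => (c (s w) (t w))%:E) : Om -> \bar R).
Proof.
by have [U [V [r cUV]]] := polish_rect_approx; exact: (measurable_cost cUV c0).
Qed.

Lemma wasserstein_shift (a : R) (M : {measure set (borel X) -> \bar R})
    (N : {measure set (borel Y) -> \bar R}) :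
  wasserstein (fun x y => c x y + a) M N = (wasserstein c M N + a%:E)%E.
Proof.
rewrite /wasserstein -ereal_inf_shift; congr ereal_inf.
have E (pi : probability (borel (X * Y)) R) :
    (\int[pi]_z (c z.1 z.2 + a)%:E = \int[pi]_z (c z.1 z.2)%:E + a%:E)%E.
  rewrite -integral_shift//.
    exact: (lsc_cost_measurable (@borel_fst X Y) (@borel_snd X Y)).
  by move=> z; rewrite lee_fin.
apply/seteqP; split => [_ [pi cpi <-]|_ [_ [pi cpi <-] <-]].
  by exists (\int[pi]_z (c z.1 z.2)%:E)%E; [exists pi|rewrite E].
by exists pi => //; rewrite E.
Qed.

End cost.

Lemma wasserstein_ext (R : realType) (X Y : ptopologicalType) (c : X -> Y -> R)
    (M M' : {measure set (borel X) -> \bar R}) (N N' : {measure set (borel Y) -> \bar R}) :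
  (M : set (borel X) -> \bar R) = M' -> (N : set (borel Y) -> \bar R) = N' ->
  wasserstein c M N = wasserstein c M' N'.
Proof. by move=> EM EN; rewrite /wasserstein /couplings EM EN. Qed.

Lemma borel_pair (Z X Y : ptopologicalType) (f : Z -> X) (g : Z -> Y) :
  continuous f -> continuous g ->
  measurable_fun setT ((fun z => (f z, g z)) : borel Z -> borel (X * Y)).
Proof.
by move=> cf cg; apply: continuous_borel => z; apply: cvg_pair; [exact: cf|exact: cg].
Qed.

(** * The formula for nonnegative costs *)

Section pivot_formula.
Context {R : realType} {X1 X2 Y1 Y2 : ptopologicalType}.
Hypotheses (pX1 : polish_space R X1) (pX2 : polish_space R X2)
  (pY1 : polish_space R Y1) (pY2 : polish_space R Y2).
Variables (mu : probability (borel (X1 * X2)) R) (nu : probability (borel (Y1 * Y2)) R)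
  (zeta : probability (borel (Y1 * X2)) R).
Variables (c1 : X1 -> Y1 -> R) (c2 : X2 -> Y2 -> R).
Hypotheses (c1_ge0 : forall x y, 0 <= c1 x y) (c2_ge0 : forall x y, 0 <= c2 x y).
Hypotheses (lc1 : lower_semicontinuous (fun z : X1 * Y1 => (c1 z.1 z.2)%:E))
  (lc2 : lower_semicontinuous (fun z : X2 * Y2 => (c2 z.1 z.2)%:E)).
Variables (m2 : probability (borel X2) R) (n1 : probability (borel Y1) R).
Variables (k1 : X2 -> probability (borel X1) R) (l1 : X2 -> probability (borel Y1) R)
  (k2 : Y1 -> probability (borel X2) R) (l2 : Y1 -> probability (borel Y2) R).
Hypotheses (mk1 : measurable_family k1) (ml1 : measurable_family l1)
  (mk2 : measurable_family k2) (ml2 : measurable_family l2).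
Hypotheses
  (mu_law : family_law m2 k1 mu (fst : borel (X1 * X2) -> X1) (snd : borel (X1 * X2) -> X2))
  (zeta_law1 : family_law m2 l1 zeta (fst : borel (Y1 * X2) -> Y1) (snd : borel (Y1 * X2) -> X2))
  (zeta_law2 : family_law n1 k2 zeta (snd : borel (Y1 * X2) -> X2) (fst : borel (Y1 * X2) -> Y1))
  (nu_law : family_law n1 l2 nu (snd : borel (Y1 * Y2) -> Y2) (fst : borel (Y1 * Y2) -> Y1)).

Let I1 := (\int[m2]_x wasserstein c1 (k1 x) (l1 x))%E.
Let I2 := (\int[n1]_y wasserstein c2 (k2 y) (l2 y))%E.

(** Under [f.1] the points [x1] and [y1] lie over the common base point [x2], with laws given by
    [mu] and [zeta]; under [f.2] the points [x2] and [y2] lie over [y1], with laws given by [zeta]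
    and [nu]. *)
Lemma fiber_cost_le_flow_cost (f : @flow R X1 X2 Y1 Y2) :
  cardinal_flows mu nu f -> same_measure (pushforward f.1 flow1_mid) zeta ->
  same_measure (pushforward f.2 flow2_mid) zeta ->
  (I1 + I2 <= flow_cost c1 c2 f)%E.
Proof.
move=> [f_mu f_nu _] f1z f2z.
have push_prob (Z Z' : ptopologicalType) (P : probability (borel Z) R)
    (P' : probability (borel Z') R) (h : borel Z -> borel Z') :
    same_measure (pushforward P h) P' -> forall A, measurable A -> prob P (h @^-1` A) = prob P' A.
  by move=> hP A mA; rewrite /prob -hP.
have [W2 [oW2 _]] := polish_base pX2; have [W1 [oW1 _]] := polish_base pY1.
have [U [V [r cUV]]] := polish_rect_approx pX1 pY1 c1_ge0 lc1.
have [U' [V' [r' cUV']]] := polish_rect_approx pX2 pY2 c2_ge0 lc2.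
have ms1 : measurable_fun setT (@flow1_src X1 X2 Y1) by exact: borel_fst.
have mm1 : measurable_fun setT (@flow1_mid X1 X2 Y1).
  apply: borel_pair => z; first exact: cvg_snd.
  by apply: continuous_comp; [exact: cvg_fst|exact: cvg_snd].
have mt2 : measurable_fun setT (@flow2_tgt X2 Y1 Y2) by exact: borel_snd.
have mm2 : measurable_fun setT (@flow2_mid X2 Y1 Y2).
  apply: borel_pair => z; last exact: cvg_fst.
  by apply: continuous_comp; [exact: cvg_snd|exact: cvg_fst].
apply: leeD.
  apply: (integral_wasserstein_le cUV c1_ge0 pX1 pY1 oW2 mk1 ml1
    (P := f.1) (x := fst \o @flow1_src X1 X2 Y1) (u := snd \o @flow1_src X1 X2 Y1)
    (y := fst \o @flow1_mid X1 X2 Y1)).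
  - exact: (family_law_comp ms1 (push_prob _ _ _ _ _ f_mu) mu_law).
  - exact: (family_law_comp mm1 (push_prob _ _ _ _ _ f1z) zeta_law1).
apply: (integral_wasserstein_le cUV' c2_ge0 pX2 pY2 oW1 mk2 ml2
  (P := f.2) (x := snd \o @flow2_mid X2 Y1 Y2) (u := fst \o @flow2_mid X2 Y1 Y2)
  (y := snd \o @flow2_tgt X2 Y1 Y2)).
- exact: (family_law_comp mm2 (push_prob _ _ _ _ _ f2z) zeta_law2).
- exact: (family_law_comp mt2 (push_prob _ _ _ _ _ f_nu) nu_law).
Qed.

Lemma coupling_flow (pi : probability (borel ((X1 * X2) * (Y1 * Y2))) R) :
  couplings mu nu pi -> exists2 f : flow, cardinal_flows mu nu f &
    flow_cost c1 c2 f = (\int[pi]_z (separable_cost c1 c2 z.1 z.2)%:E)%E.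
Proof.
move=> [pi_mu pi_nu].
pose Z : ptopologicalType := ((X1 * X2) * (Y1 * Y2))%type.
have c_11 : continuous (fun z : Z => z.1) by move=> z; exact: cvg_fst.
have c_2 : continuous (fun z : Z => z.2) by move=> z; exact: cvg_snd.
have c_12 : continuous (fun z : Z => z.1.2).
  by move=> z; apply: continuous_comp; [exact: cvg_fst|exact: cvg_snd].
have c_21 : continuous (fun z : Z => z.2.1).
  by move=> z; apply: continuous_comp; [exact: cvg_snd|exact: cvg_fst].
pose h1 (z : borel Z) : borel (X1 * X2 * Y1) := (z.1, z.2.1).
pose h2 (z : borel Z) : borel (X2 * (Y1 * Y2)) := (z.1.2, z.2).
have mh1 : measurable_fun setT h1 by exact: borel_pair.
have mh2 : measurable_fun setT h2 by exact: borel_pair.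
have [f1 f1E] := pushforward_probability pi mh1.
have [f2 f2E] := pushforward_probability pi mh2.
exists (f1, f2).
  split => A mA.
  - exact: etrans (congr1 (fun F => F (@flow1_src X1 X2 Y1 @^-1` A)) f1E) (pi_mu A mA).
  - exact: etrans (congr1 (fun F => F (@flow2_tgt X2 Y1 Y2 @^-1` A)) f2E) (pi_nu A mA).
  - apply: etrans (congr1 (fun F => F (@flow1_mid X1 X2 Y1 @^-1` A)) f1E) _.
    exact: etrans (esym (congr1 (fun F => F (@flow2_mid X2 Y1 Y2 @^-1` A)) f2E)).
have mc1 : measurable_fun setT ((fun z => (c1 z.1.1 z.2)%:E) : borel (X1 * X2 * Y1) -> \bar R).
  apply: (lsc_cost_measurable pX1 pY1 c1_ge0 lc1); last exact: borel_snd.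
  by apply: continuous_borel => z; apply: continuous_comp; exact: cvg_fst.
have mc2 : measurable_fun setT ((fun z => (c2 z.1 z.2.2)%:E) : borel (X2 * (Y1 * Y2)) -> \bar R).
  apply: (lsc_cost_measurable pX2 pY2 c2_ge0 lc2); first exact: borel_fst.
  by apply: continuous_borel => z; apply: continuous_comp; exact: cvg_snd.
rewrite /flow_cost/= f1E f2E (ge0_integral_pushforward mh1)//; last by move=> z _; rewrite lee_fin.
rewrite (ge0_integral_pushforward mh2)//; last by move=> z _; rewrite lee_fin.
rewrite !preimage_setT -ge0_integralD//.
- by move=> z _; rewrite lee_fin.
- exact: measurableT_comp mc1 mh1.
- by move=> z _; rewrite lee_fin.
- exact: measurableT_comp mc2 mh2.
Qed.

(** [g3] lives on a source, two copies of the middle pair, and a target. Almost surely the copies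
    agree, and they match [x2] of the source and [y1] of the target, so the separable cost between
    source and target splits into the costs of [g1] and [g2]. *)
Lemma glued_coupling : exists2 pi : probability (borel ((X1 * X2) * (Y1 * Y2))) R,
  couplings mu nu pi & (\int[pi]_z (separable_cost c1 c2 z.1 z.2)%:E <= I1 + I2)%E.
Proof.
have pX := prod_polish pX1 pX2; have pQ := prod_polish pY1 pX2; have pY := prod_polish pY1 pY2.
have [W2 bW2] := polish_base pX2; have [W1 bW1] := polish_base pY1.
have [WQ bWQ] := polish_base pQ; have [BX bBX] := polish_base pX; have [BY bBY] := polish_base pY.
have [U [V [r cUV]]] := polish_rect_approx pX1 pY1 c1_ge0 lc1.
have [U' [V' [r' cUV']]] := polish_rect_approx pX2 pY2 c2_ge0 lc2.
have [g1 [co1 cost1 d1]] := integral_wasserstein_coupling cUV c1_ge0 pX1 pY1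
  (proj1 bW2) mk1 ml1 pQ mu_law zeta_law1.
have [g2 [co2 cost2 d2]] := integral_wasserstein_coupling cUV' c2_ge0 pX2 pY2
  (proj1 bW1) mk2 ml2 pY zeta_law2 nu_law.
(* [gluing] wants the Borel sets of a Polish space as its second factor, so [g2] is moved there from
   the product sigma-algebra. *)
have mid := measurable_prod_borel bWQ bBY.
have [g2' g2'E] := pushforward_probability g2 mid.
have g2'p A : prob g2' A = prob g2 A.
  exact: (congr1 (fun F : set _ -> \bar R => fine (F A)) g2'E).
pose T : ptopologicalType := ((Y1 * X2) * (Y1 * Y2))%type.
have pT : polish_space R T by exact: prod_polish.
have [|g3 co3 d3] := gluing (T := T) (M := g1) (N := g2') (u := snd) (v := fst) pQ pT
  measurable_snd (@borel_fst _ _) _ (proj1 bWQ).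
  move=> E mE; rewrite (coupled_snd co1)//.
  by apply: esym; apply: etrans (g2'p _) _; exact: (coupled_fst co2).
pose S := (borel (X1 * X2) * borel (Y1 * X2))%type.
pose h (z : S * borel T) : borel ((X1 * X2) * (Y1 * Y2)) := (z.1.1, z.2.2).
have m1 : measurable_fun setT (fst : S * borel T -> S) by exact: measurable_fst.
have m2' : measurable_fun setT (snd : S * borel T -> borel T) by exact: measurable_snd.
have m11 : measurable_fun setT ((fun z => z.1.1) : S * borel T -> borel (X1 * X2)).
  exact: (measurableT_comp measurable_fst m1).
have m12 : measurable_fun setT ((fun z => z.1.2) : S * borel T -> borel (Y1 * X2)).
  exact: (measurableT_comp measurable_snd m1).
have m21 : measurable_fun setT ((fun z => z.2.1) : S * borel T -> borel (Y1 * X2)).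
  exact: (measurableT_comp (@borel_fst _ _) m2').
have m22 : measurable_fun setT ((fun z => z.2.2) : S * borel T -> borel (Y1 * Y2)).
  exact: (measurableT_comp (@borel_snd _ _) m2').
have mh : measurable_fun setT h.
  exact: (measurableT_comp (measurable_prod_borel bBX bBY) (measurable_fun_pair m11 m22)).
have [pi piE] := pushforward_probability g3 mh.
have co3fst := coupled_fst co3; have co3snd := coupled_snd co3.
have prob_eqE d d' (O1 : measurableType d) (O2 : measurableType d') (P : probability O1 R)
    (P' : probability O2 R) A B : measurable A -> measurable B -> prob P A = prob P' B ->
    P A = P' B.
  by move=> mA mB AB; exact: etrans (probE P mA) (etrans (congr1 EFin AB) (esym (probE P' mB))).
exists pi.
  split => A mA.
    apply: etrans (congr1 (fun F => F (fst @^-1` A)) piE) _.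
    apply: prob_eqE => //; first by rewrite -[X in measurable X]setTI; exact: m11.
    rewrite -(coupled_fst co1)// -co3fst//.
    by rewrite -[X in measurable X]setTI; exact: measurable_fst.
  apply: etrans (congr1 (fun F => F (snd @^-1` A)) piE) _.
  apply: prob_eqE => //; first by rewrite -[X in measurable X]setTI; exact: m22.
  rewrite -(coupled_snd co2)// -g2'p -co3snd//.
  by rewrite -[X in measurable X]setTI; exact: borel_snd.
have msep : measurable_fun setT
    ((fun z => (separable_cost c1 c2 z.1 z.2)%:E) : borel ((X1 * X2) * (Y1 * Y2)) -> \bar R).
  have mA : measurable_fun setT
      ((fun z => (c1 z.1.1 z.2.1)%:E) : borel ((X1 * X2) * (Y1 * Y2)) -> \bar R).
    apply: (lsc_cost_measurable pX1 pY1 c1_ge0 lc1).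
      exact: (measurableT_comp (@borel_fst _ _) (@borel_fst _ _)).
    exact: (measurableT_comp (@borel_fst _ _) (@borel_snd _ _)).
  have mB : measurable_fun setT
      ((fun z => (c2 z.1.2 z.2.2)%:E) : borel ((X1 * X2) * (Y1 * Y2)) -> \bar R).
    apply: (lsc_cost_measurable pX2 pY2 c2_ge0 lc2).
      exact: (measurableT_comp (@borel_snd _ _) (@borel_fst _ _)).
    exact: (measurableT_comp (@borel_snd _ _) (@borel_snd _ _)).
  exact: (emeasurable_funD mA mB).
rewrite piE (ge0_integral_pushforward mh)//; last first.
  by move=> z _; rewrite lee_fin addr_ge0.
rewrite preimage_setT.
have msnd (A B : ptopologicalType) (E : set (borel B)) : measurable E ->
    measurable (snd @^-1` E : set (borel (A * B))).
  by move=> mE; rewrite -[X in measurable X]setTI; exact: borel_snd.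
have mfst (A B : ptopologicalType) (E : set (borel A)) : measurable E ->
    measurable (fst @^-1` E : set (borel (A * B))).
  by move=> mE; rewrite -[X in measurable X]setTI; exact: borel_fst.
have mX (A B : ptopologicalType) (E : set (borel A)) (E' : set (borel B)) :
    measurable E -> measurable E' -> measurable (E `*` E' : set (borel (A * B))).
  by move=> mE mE'; exact: (measurableI _ _ (mfst _ _ _ mE) (msnd _ _ _ mE')).
have ae1 : {ae g3, forall z, z.1.1.2 = z.1.2.2}.
  apply: (diagonal_ae bW2 pX2).
  - exact: (measurableT_comp (@borel_snd _ _) m11).
  - exact: (measurableT_comp (@borel_snd _ _) m12).
  - move=> i; have mWi : measurable (W2 i : set (borel X2)).
      by apply: borel_open; case: bW2.
    apply: etrans (co3fst _ _) (d1 i); apply: measurableX.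
      exact: (msnd _ _ _ mWi).
    exact: (msnd _ _ _ (measurableC mWi)).
have ae2 : {ae g3, forall z, z.2.1.1 = z.2.2.1}.
  apply: (diagonal_ae bW1 pY1).
  - exact: (measurableT_comp (@borel_fst _ _) m21).
  - exact: (measurableT_comp (@borel_fst _ _) m22).
  - move=> i; have mWi : measurable (W1 i : set (borel Y1)).
      by apply: borel_open; case: bW1.
    apply: etrans (co3snd _ _) (etrans (g2'p _) (d2 i)); apply: mX.
      exact: (mfst _ _ _ mWi).
    exact: (mfst _ _ _ (measurableC mWi)).
have ae3 : {ae g3, forall z, z.1.2 = z.2.1}.
  by apply: (diagonal_ae bWQ pQ).
pose F1 (z : S) := (c1 z.1.1 z.2.1)%:E; pose F2 (z : borel T) := (c2 z.1.2 z.2.2)%:E.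
have mF1 : measurable_fun setT (F1 : S -> \bar R).
  apply: (lsc_cost_measurable pX1 pY1 c1_ge0 lc1).
    exact: (measurableT_comp (@borel_fst _ _) measurable_fst).
  exact: (measurableT_comp (@borel_fst _ _) measurable_snd).
have mF2 : measurable_fun setT (F2 : borel T -> \bar R).
  apply: (lsc_cost_measurable pX2 pY2 c2_ge0 lc2).
    exact: (measurableT_comp (@borel_snd _ _) (@borel_fst _ _)).
  exact: (measurableT_comp (@borel_snd _ _) (@borel_snd _ _)).
have mF1' := measurableT_comp mF1 m1; have mF2' := measurableT_comp mF2 m2'.
rewrite (ge0_ae_eq_integral (g := fun z => (F1 z.1 + F2 z.2)%E))//; first last.
- apply: (@filterS3 _ _ (ae_filter_ringOfSetsType g3) _ _ _ _ _ ae1 ae2 ae3) => z e1 e2 e3 _.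
  by rewrite /F1 /F2 /= /separable_cost -EFinD /= e3 e2 -e3 -e1.
- by move=> z _; rewrite adde_ge0// lee_fin.
- by move=> z _; rewrite lee_fin addr_ge0.
- exact: emeasurable_funD.
- exact: (measurableT_comp msep mh).
rewrite ge0_integralD//; first last.
- by move=> z _; rewrite lee_fin.
- by move=> z _; rewrite lee_fin.
apply: leeD.
  by rewrite (integral_same_law m1 co3fst mF1) ?cost1// => z; rewrite lee_fin.
rewrite (integral_same_law m2' co3snd mF2); last by move=> z; rewrite lee_fin.
rewrite -(integral_same_law (P := g2) mid (fun A _ => esym (g2'p A)) mF2)//.
by move=> z; rewrite lee_fin.
Qed.

End pivot_formula.

Lemma lsc_section (R : realType) (X Y X' Y' : topologicalType) (c : X -> Y -> R)
    (C : X' -> Y' -> R) (f : X -> X') (g : Y -> Y') (b : R) :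
  continuous f -> continuous g -> (forall x y, c x y = C (f x) (g y) + b) ->
  lower_semicontinuous (fun z : X' * Y' => (C z.1 z.2)%:E) ->
  lower_semicontinuous (fun z : X * Y => (c z.1 z.2)%:E).
Proof.
move=> cf cg cE lC [x y] a; rewrite lte_fin /= cE -ltrBlDr => aC.
have [|V hV VC] := lC (f x, g y) (a - b); first by rewrite lte_fin.
have hf : continuous (fun z : X * Y => f z.1).
  by move=> z; apply: continuous_comp; [exact: cvg_fst|exact: cf].
have hg : continuous (fun z : X * Y => g z.2).
  by move=> z; apply: continuous_comp; [exact: cvg_snd|exact: cg].
exists [set z | V (f z.1, g z.2)]; first exact: (cvg_pair (hf (x, y)) (hg (x, y)) hV).
by move=> z /VC; rewrite !lte_fin /= cE ltrBlDr.
Qed.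

Theorem theorem4 (R : realType) (X1 X2 Y1 Y2 : ptopologicalType)
  (hX1 : polish_space R X1) (hX2 : polish_space R X2)
  (hY1 : polish_space R Y1) (hY2 : polish_space R Y2)
  (mu : probability (borel (X1 * X2)) R)
  (nu : probability (borel (Y1 * Y2)) R)
  (c1 : X1 -> Y1 -> R) (c2 : X2 -> Y2 -> R)
  (c_ge0 : forall x y, 0 <= separable_cost c1 c2 x y)
  (c_lsc : lower_semicontinuous
     (fun z : (X1 * X2) * (Y1 * Y2) => (separable_cost c1 c2 z.1 z.2)%:E))
  (zeta : probability (borel (Y1 * X2)) R)
  (zeta_pivot : pivot c1 c2 mu nu zeta)
  (mu_x2 : R.-pker borel X2 ~> borel X1)
  (zeta_x2 : R.-pker borel X2 ~> borel Y1)
  (zeta_y1 : R.-pker borel Y1 ~> borel X2)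
  (nu_y1 : R.-pker borel Y1 ~> borel Y2)
  (h_mu_x2 : conditional_law mu snd fst mu_x2)
  (h_zeta_x2 : conditional_law zeta snd fst zeta_x2)
  (h_zeta_y1 : conditional_law zeta fst snd zeta_y1)
  (h_nu_y1 : conditional_law nu fst snd nu_y1) :
  let mu2 := pushforward mu (snd : borel (X1 * X2) -> borel X2) in
  let nu1 := pushforward nu (fst : borel (Y1 * Y2) -> borel Y1) in
  (wasserstein (separable_cost c1 c2) mu nu =
   \int[mu2]_x2 wasserstein c1 (mu_x2 x2) (zeta_x2 x2) +
   \int[nu1]_y1 wasserstein c2 (zeta_y1 y1) (nu_y1 y1))%E.
Proof.
move=> mu2 nu1.
have [f [[flow_f opt_f] f1z f2z]] := zeta_pivot.
have [f_mu f_nu _] := flow_f.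
(* Since the arguments of [c1] and [c2] are independent, nonnegativity of the sum bounds [c1] below
   by every [- c2 p q]. So [b] is a genuine infimum, and [c1 - b] and [c2 + b] are nonnegative with
   the same sum. *)
pose E := [set c1 z.1 z.2 | z in [set: X1 * Y1]]; pose b := inf E.
have c12 x y p q : - c2 p q <= c1 x y.
  by rewrite lerNl -subr_ge0 opprK addrC; exact: (c_ge0 (x, p) (y, q)).
have E0 : E !=set0 by exists (c1 point point), (point, point).
have bE x y : b <= c1 x y.
  apply: ge_inf; last by exists (x, y).
  by exists (- c2 point point) => _ [z _ <-].
have bc2 p q : - b <= c2 p q.
  rewrite lerNl; apply: lb_le_inf => // _ [z _ <-]; exact: c12.
pose d1 x y := c1 x y - b; pose d2 p q := c2 p q + b.
have d1_ge0 x y : 0 <= d1 x y by rewrite subr_ge0.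
have d2_ge0 p q : 0 <= d2 p q by rewrite -lerBlDr sub0r.
have c1E : c1 = fun x y => d1 x y + b.
  by apply/funext => x; apply/funext => y; rewrite subrK.
have c2E : c2 = fun p q => d2 p q + - b.
  by apply/funext => p; apply/funext => q; rewrite addrK.
have cE : separable_cost c1 c2 = separable_cost d1 d2.
  apply/funext => x; apply/funext => y.
  by rewrite /separable_cost /d1 /d2 addrACA [- b + b]addrC subrr addr0.
have ld1 : lower_semicontinuous (fun z : X1 * Y1 => (d1 z.1 z.2)%:E).
  apply: (@lsc_section R X1 Y1 (X1 * X2)%type (Y1 * Y2)%type d1 (separable_cost c1 c2)
    (fun x => (x, point)) (fun y => (y, point)) (- c2 point point - b)) => //.
  - by move=> x; apply: cvg_pair; [exact: cvg_id|exact: cvg_cst].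
  - by move=> x; apply: cvg_pair; [exact: cvg_id|exact: cvg_cst].
  - by move=> x y; rewrite /separable_cost /d1 /= addrA addrK.
have ld2 : lower_semicontinuous (fun z : X2 * Y2 => (d2 z.1 z.2)%:E).
  apply: (@lsc_section R X2 Y2 (X1 * X2)%type (Y1 * Y2)%type d2 (separable_cost c1 c2)
    (fun x => (point, x)) (fun y => (point, y)) (- c1 point point + b)) => //.
  - by move=> x; apply: cvg_pair; [exact: cvg_cst|exact: cvg_id].
  - by move=> x; apply: cvg_pair; [exact: cvg_cst|exact: cvg_id].
  - by move=> x y; rewrite /separable_cost /d2 /=; ring.
(* Optimality is stated for [c1] and [c2]; the constants [b] and [- b] cancel against the two
   probabilities, so it transfers to [d1] and [d2]. *)
have flowE g : flow_cost c1 c2 g = flow_cost d1 d2 g.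
  have mc1 : measurable_fun setT
      ((fun z => (d1 z.1.1 z.2)%:E) : borel (X1 * X2 * Y1) -> \bar R).
    apply: (lsc_cost_measurable hX1 hY1 d1_ge0 ld1); last exact: borel_snd.
    exact: (measurableT_comp (@borel_fst _ _) (@borel_fst _ _)).
  have mc2 : measurable_fun setT
      ((fun z => (d2 z.1 z.2.2)%:E) : borel (X2 * (Y1 * Y2)) -> \bar R).
    apply: (lsc_cost_measurable hX2 hY2 d2_ge0 ld2); first exact: borel_fst.
    exact: (measurableT_comp (@borel_snd _ _) (@borel_snd _ _)).
  rewrite /flow_cost c1E c2E.
  rewrite [X in (X + _)%E](_ : _ = (\int[g.1]_z (d1 z.1.1 z.2)%:E + b%:E)%E); last first.
    by rewrite -integral_shift// => z; rewrite lee_fin.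
  rewrite [X in (_ + X)%E](_ : _ = (\int[g.2]_z (d2 z.1 z.2.2)%:E + (- b)%:E)%E); last first.
    by rewrite -integral_shift// => z; rewrite lee_fin.
  by rewrite addeACA -EFinD subrr adde0.
have [k1 mk1 k1E] := kernel_family mu_x2; have [l1 ml1 l1E] := kernel_family zeta_x2.
have [k2 mk2 k2E] := kernel_family zeta_y1; have [l2 ml2 l2E] := kernel_family nu_y1.
have [m2 m2E] := pushforward_probability mu (@borel_snd X1 X2).
have [n1 n1E] := pushforward_probability nu (@borel_fst Y1 Y2).
have mX2 (A : set (borel X2)) : measurable A -> measurable (snd @^-1` A : set (borel (X1 * X2))).
  by move=> mA; rewrite -[X in measurable X]setTI; exact: borel_snd.
have mX2' (A : set (borel X2)) : measurable A -> measurable (snd @^-1` A : set (borel (Y1 * X2))).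
  by move=> mA; rewrite -[X in measurable X]setTI; exact: borel_snd.
have mY1 (A : set (borel Y1)) : measurable A -> measurable (fst @^-1` A : set (borel (Y1 * Y2))).
  by move=> mA; rewrite -[X in measurable X]setTI; exact: borel_fst.
have mY1' (A : set (borel Y1)) : measurable A -> measurable (fst @^-1` A : set (borel (Y1 * X2))).
  by move=> mA; rewrite -[X in measurable X]setTI; exact: borel_fst.
have mu_law := conditional_family_law h_mu_x2 k1E (@borel_snd _ _) (@borel_fst _ _)
  (fun A _ => esym (congr1 (fun F => F A) m2E)).
have nu_law := conditional_family_law h_nu_y1 l2E (@borel_fst _ _) (@borel_snd _ _)
  (fun A _ => esym (congr1 (fun F => F A) n1E)).
(* The [X2]-marginals of [zeta] and [mu] agree because [flow1_mid] and [flow1_src] share the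
   coordinate [x2]. For [zeta_law2], the [Y1]-marginals of [zeta] and [nu] are compared likewise
   through [f.2]. *)
have zeta_law1 : family_law m2 l1 zeta
    (fst : borel (Y1 * X2) -> Y1) (snd : borel (Y1 * X2) -> X2).
  apply: (conditional_family_law h_zeta_x2 l1E (@borel_snd _ _) (@borel_fst _ _)) => A mA.
  apply: etrans (esym (f1z _ (mX2' _ mA))) _; rewrite m2E; exact: f_mu (mX2 _ mA).
have zeta_law2 : family_law n1 k2 zeta
    (snd : borel (Y1 * X2) -> X2) (fst : borel (Y1 * X2) -> Y1).
  apply: (conditional_family_law h_zeta_y1 k2E (@borel_fst _ _) (@borel_snd _ _)) => A mA.
  apply: etrans (esym (f2z _ (mY1' _ mA))) _; rewrite n1E; exact: f_nu (mY1 _ mA).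
have [W1 [oW1 _]] := polish_base hY1; have [W2 [oW2 _]] := polish_base hX2.
have [U [V [r dUV]]] := polish_rect_approx hX1 hY1 d1_ge0 ld1.
have [U' [V' [r' dUV']]] := polish_rect_approx hX2 hY2 d2_ge0 ld2.
have mI1 := measurable_wasserstein m2 dUV d1_ge0 hX1 hY1 oW2 mk1 ml1.
have mI2 := measurable_wasserstein n1 dUV' d2_ge0 hX2 hY2 oW1 mk2 ml2.
have I1E : (\int[mu2]_x2 wasserstein c1 (mu_x2 x2) (zeta_x2 x2) =
    \int[m2]_x wasserstein d1 (k1 x) (l1 x) + b%:E)%E.
  rewrite -integral_shift; first last.
  - by move=> x; exact: (wasserstein_ge0 d1_ge0).
  - exact: mI1.
  transitivity (\int[m2]_x wasserstein c1 (mu_x2 x) (zeta_x2 x))%E; first by rewrite m2E.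
  apply: eq_integral => x _; rewrite c1E (wasserstein_shift hX1 hY1 d1_ge0 ld1).
  congr (_ + _)%E; apply: wasserstein_ext.
    exact: esym (k1E x).
  exact: esym (l1E x).
have I2E : (\int[nu1]_y1 wasserstein c2 (zeta_y1 y1) (nu_y1 y1) =
    \int[n1]_y wasserstein d2 (k2 y) (l2 y) + (- b)%:E)%E.
  rewrite -integral_shift; first last.
  - by move=> x; exact: (wasserstein_ge0 d2_ge0).
  - exact: mI2.
  transitivity (\int[n1]_y wasserstein c2 (zeta_y1 y) (nu_y1 y))%E; first by rewrite n1E.
  apply: eq_integral => x _; rewrite c2E (wasserstein_shift hX2 hY2 d2_ge0 ld2).
  congr (_ + _)%E; apply: wasserstein_ext.
    exact: esym (k2E x).
  exact: esym (l2E x).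
rewrite I1E I2E addeACA -EFinD subrr adde0 cE.
apply/eqP; rewrite eq_le; apply/andP; split.
  have [pi cpi piE] := glued_coupling hX1 hX2 hY1 hY2 d1_ge0 d2_ge0 ld1 ld2
    mk1 ml1 mk2 ml2 mu_law zeta_law1 zeta_law2 nu_law.
  by apply: le_trans piE; apply: ereal_inf_lbound; exists pi.
apply: le_ereal_inf_tmp => _ [pi cpi <-].
have [g flow_g <-] := coupling_flow hX1 hX2 hY1 hY2 d1_ge0 d2_ge0 ld1 ld2 cpi.
(* The projected flow competes with the flow behind the pivot; optimality enters here. *)
apply: (@le_trans _ _ (flow_cost d1 d2 f)); last by rewrite -!flowE; exact: opt_f.
exact: (fiber_cost_le_flow_cost hX1 hX2 hY1 hY2 d1_ge0 d2_ge0 ld1 ld2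
  mk1 ml1 mk2 ml2 mu_law zeta_law1 zeta_law2 nu_law flow_f f1z f2z).
Qed.
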